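(* Let $(M,g)$ be a smooth $n$-dimensional Riemannian manifold, $n\ge 3$, with Ricci tensor $\mathsf{Ri}\ne 0$. Suppose that $\mathsf{Ri}$ is pseudo Ricci symmetric and that the scalar curvature satisfies $\mathsf{sc}\neq 0$. Then: (i) if $\mathsf{Ri}$ is also quasi Einstein with $a\ne 0$, then it is Cotton; (ii) if $\mathsf{Ri}$ is also Cotton, then it is quasi Einstein.
   Context: $g$ is positive definite, a semicolon denotes covariant differentiation with respect to the Levi-Civita connection, $|\cdot|$ is the pointwise norm induced by $g$, and $\mathsf{sc}=g^{ij}\mathsf{Ri}_{ij}$ is the scalar curvature. The Ricci tensor is pseudo Ricci symmetric if there is a nonzero one-form $\alpha$ such that $\mathsf{Ri}_{ij;\ell}=2\alpha_\ell\mathsf{Ri}_{ij}+\alpha_i\mathsf{Ri}_{\ell j}+\alpha_j\mathsf{Ri}_{i\ell}$. It is quasi Einstein if there are functions $a$ and $b$ and a one-form $\omega$ such that $\mathsf{Ri}=a\,g+b\,\frac{\omega\otimes\omega}{|\omega|^2}$ (if $b=0$ the Ricci tensor is Einstein); the function $a$ in (i) is the one in this formula. The Schouten tensor is $S=\mathsf{Ri}-\frac{\mathsf{sc}}{2n-2}\,g$, the Cotton tensor is $C_{ijk}=S_{ij;k}-S_{ik;j}$, and the Ricci tensor is Cotton if the Cotton tensor is zero. *)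

(* Defs.v *)
From HB Require Import structures.
From mathcomp Require Import all_boot all_order all_algebra.
From mathcomp Require Import all_classical all_reals all_analysis.

Set Implicit Arguments.
Unset Strict Implicit.
Unset Printing Implicit Defensive.

Import Order.TTheory GRing.Theory Num.Theory.
Import numFieldNormedType.Exports.

Local Open Scope classical_set_scope.
Local Open Scope ring_scope.

Section Calculus.
Context {R : realType} {n : nat}.
Implicit Types (U : set 'rV[R]_n) (f : 'rV[R]_n -> R) (x : 'rV[R]_n).

Definition pderiv (i : 'I_n) f x : R := 'D_(delta_mx 0 i) f x.

(* [U] is always an open set below. *)
Fixpoint Ck (k : nat) U f : Prop :=
  (forall x, U x -> {for x, continuous f}) /\
  match k with
  | 0 => True
  | k'.+1 => forall i : 'I_n,
      (forall x, U x -> derivable f x (delta_mx 0 i)) /\ Ck k' U (pderiv i f)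
  end.

Definition Cinfty U f : Prop := forall k, Ck k U f.

End Calculus.

(* A smooth n-manifold without boundary, given by an atlas [mchart]; [ccoord c]
   is a homeomorphism from [cdom c] onto the open set [crange c], with inverse
   [cparam c].  The values of [ccoord c] and [cparam c] outside [cdom c] and
   [crange c] are irrelevant. *)
Record smoothManifold (R : realType) (n : nat) := SmoothManifold {
  mpoint :> topologicalType;
  mpoint_hausdorff : hausdorff_space mpoint;
  mpoint_countable : @second_countable mpoint;
  mchart : Type;
  cdom : mchart -> set mpoint;
  ccoord : mchart -> mpoint -> 'rV[R]_n;
  cparam : mchart -> 'rV[R]_n -> mpoint;
  cdom_open : forall c, open (cdom c);
  cdom_cover : forall p, exists c, cdom c p;
  crange_open : forall c, open (ccoord c @` cdom c);
  ccoordK : forall c p, cdom c p -> cparam c (ccoord c p) = p;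
  ccoord_continuous : forall c, {within cdom c, continuous (ccoord c)};
  cparam_continuous :
    forall c, {within ccoord c @` cdom c, continuous (cparam c)};
  transition_smooth : forall c d (k : 'I_n),
    Cinfty (ccoord c @` (cdom c `&` cdom d))
           (fun x => ccoord d (cparam c x) 0 k)
}.

Section Fields.
Context {R : realType} {n : nat} (M : smoothManifold R n).
Implicit Types (c d : mchart M) (x : 'rV[R]_n).

Definition crange c : set 'rV[R]_n := ccoord c @` cdom c.
Definition coverlap c d : set 'rV[R]_n := ccoord c @` (cdom c `&` cdom d).

Definition transition c d x : 'rV[R]_n := ccoord d (cparam c x).

(* [jac c d x i k] is the derivative of the k-th d-coordinate with respect to
   the i-th c-coordinate. *)
Definition jac c d x (i k : 'I_n) : R :=
  pderiv i (fun y => transition c d y 0 k) x.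

Definition smooth_fun (f : M -> R) : Prop :=
  forall c, Cinfty (crange c) (f \o cparam c).

Definition nowhere_zero_fun (f : M -> R) : Prop := forall p, f p != 0.

Record oneForm := OneForm {
  ofcomp :> mchart M -> 'rV[R]_n -> 'rV[R]_n;
  of_smooth : forall c i, Cinfty (crange c) (fun x => ofcomp c x 0 i);
  of_change : forall c d x, coverlap c d x -> forall i,
    ofcomp c x 0 i =
    \sum_k jac c d x i k * ofcomp d (transition c d x) 0 k
}.

Definition nowhere_zero_form (w : oneForm) : Prop :=
  forall c x, crange c x -> w c x != 0.

Record riemannianMetric := RiemannianMetric {
  gcomp :> mchart M -> 'rV[R]_n -> 'M[R]_n;
  g_smooth : forall c i j, Cinfty (crange c) (fun x => gcomp c x i j);
  g_change : forall c d x, coverlap c d x -> forall i j,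
    gcomp c x i j =
    \sum_k \sum_l
      jac c d x i k * jac c d x j l * gcomp d (transition c d x) k l;
  g_sym : forall c x, crange c x -> (gcomp c x)^T = gcomp c x;
  g_posdef : forall c x, crange c x -> forall v : 'rV[R]_n, v != 0 ->
    0 < (v *m gcomp c x *m v^T) 0 0
}.

End Fields.

(* Tensors derived from the metric, by their components in the chart [c] at
   the coordinate vector [x]. *)
Section Curvature.
Context {R : realType} {n : nat} {M : smoothManifold R n}.
Context (g : riemannianMetric M).
Implicit Types (c : mchart M) (x : 'rV[R]_n) (i j k l m : 'I_n).

Definition ginv c x i j : R := invmx (g c x) i j.

(* The Levi-Civita connection: [christoffel c m i j x] is Gamma^m_{ij}. *)
Definition christoffel c m i j x : R :=
  2^-1 * \sum_k ginv c x m k *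
    (pderiv i (fun y => g c y k j) x + pderiv j (fun y => g c y k i) x
     - pderiv k (fun y => g c y i j) x).

(* [riemann c l k i j x] is the l-th component of
   (nabla_i nabla_j - nabla_j nabla_i) e_k. *)
Definition riemann c l k i j x : R :=
  pderiv i (christoffel c l j k) x - pderiv j (christoffel c l i k) x
  + \sum_m (christoffel c l i m x * christoffel c m j k x
            - christoffel c l j m x * christoffel c m i k x).

(* With these signs the round sphere has positive Ricci tensor. *)
Definition ricci c i j x : R := \sum_l riemann c l i l j x.

Definition scal c x : R := \sum_i \sum_j ginv c x i j * ricci c i j x.

(* [covderiv2 c T i j l x] is T_{ij;l}. *)
Definition covderiv2 c (T : 'I_n -> 'I_n -> 'rV[R]_n -> R) i j l x : R :=
  pderiv l (T i j) x
  - \sum_m (christoffel c m l i x * T m j x + christoffel c m l j x * T i m x).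

Definition schouten c i j x : R :=
  ricci c i j x - scal c x / (2 * n%:R - 2) * g c x i j.

Definition cotton c i j k x : R :=
  covderiv2 c (schouten c) i j k x - covderiv2 c (schouten c) i k j x.

Definition normsq (w : oneForm M) c x : R :=
  \sum_i \sum_j ginv c x i j * w c x 0 i * w c x 0 j.

Definition ricci_nonzero : Prop :=
  exists c x, crange c x /\ exists i j, ricci c i j x != 0.

Definition scal_nonzero : Prop := exists c x, crange c x /\ scal c x != 0.

Definition pseudo_ricci_symmetric : Prop :=
  exists2 alpha : oneForm M, nowhere_zero_form alpha &
  forall c x, crange c x -> forall i j l,
    covderiv2 c (ricci c) i j l x =
    2 * alpha c x 0 l * ricci c i j x + alpha c x 0 i * ricci c l j x
    + alpha c x 0 j * ricci c i l x.

Definition quasi_einstein_with (a b : M -> R) (w : oneForm M) : Prop :=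
  [/\ smooth_fun a, smooth_fun b, nowhere_zero_form w &
    forall c x, crange c x -> forall i j,
      ricci c i j x =
      a (cparam c x) * g c x i j
      + b (cparam c x) * (w c x 0 i * w c x 0 j / normsq w c x)].

Definition quasi_einstein : Prop := exists a b w, quasi_einstein_with a b w.

Definition ricci_cotton : Prop :=
  forall c x, crange c x -> forall i j k, cotton c i j k x = 0.

End Curvature.

(* Main.v *)
Require Import Defs.
From HB Require Import structures.
From mathcomp Require Import all_boot all_order all_algebra.
From mathcomp Require Import all_classical all_reals all_analysis.
From mathcomp Require Import ring lra.

(* Contracting the pseudo Ricci symmetry equation in its two possible ways and
   comparing with the contracted Bianchi identity gives [Ric(alpha, .) = 0] and
   [d sc = 2 sc alpha], hence
     C_ijk = alpha_k (Ri_ij - sc/(n-1) g_ij) - alpha_j (Ri_ik - sc/(n-1) g_ik).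
   If [Ri = a g + b w(x)w/|w|^2] with [a <> 0], then [Ri alpha = 0] forces [w] to
   be proportional to [alpha] and [b = -a], so [sc = (n-1) a] and [C = 0].
   Conversely, contracting [C = 0] with [alpha^k] gives
   [Ri = sc/(n-1) (g - alpha(x)alpha/|alpha|^2)].

   Levi-Civita calculus is carried out over an abstract commutative ring with
   commuting derivations, which removes all differentiability side conditions;
   it is applied to the ring of smooth functions on an open set of coordinates.
   The coordinate invariance of [sc], needed for a globally defined [a], is the
   gauge transformation law [N_i J = d_i J + J Theta_i] of connection matrices. *)

Set Implicit Arguments.
Unset Strict Implicit.
Unset Printing Implicit Defensive.

Import Order.TTheory GRing.Theory Num.Theory.
Import numFieldNormedType.Exports.

Local Open Scope classical_set_scope.
Local Open Scope ring_scope.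

(** * Levi-Civita calculus over a ring with commuting derivations *)

Record commuting_derivations (A : comPzRingType) (n : nat) := CommutingDerivations {
  der :> 'I_n -> A -> A;
  derD : forall i, {morph der i : x y / x + y};
  derM : forall i x y, der i (x * y) = der i x * y + x * der i y;
  derC : forall i j x, der i (der j x) = der j (der i x)
}.

Section DerivationTheory.
Context {A : comPzRingType} {n : nat} (d : commuting_derivations A n).
Implicit Types (i j : 'I_n) (x y : A).

Lemma der0 i : d i 0 = 0.
Proof. by apply: (@addrI _ (d i 0)); rewrite -derD !addr0. Qed.

Lemma derN i x : d i (- x) = - d i x.
Proof. by apply/eqP; rewrite -subr_eq0 opprK -derD addNr der0. Qed.

Lemma derB i x y : d i (x - y) = d i x - d i y.
Proof. by rewrite derD derN. Qed.

Lemma der1 i : d i 1 = 0.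
Proof.
by apply: (@addrI _ (d i 1)); rewrite addr0 -{3}(mulr1 1) derM mulr1 mul1r.
Qed.

Lemma der_sum i (I : Type) (r : seq I) (P : pred I) (F : I -> A) :
  d i (\sum_(k <- r | P k) F k) = \sum_(k <- r | P k) d i (F k).
Proof. exact: (big_morph _ (derD d i) (der0 i)). Qed.

Lemma dermxM i (m p q : nat) (M : 'M[A]_(m, p)) (N : 'M[A]_(p, q)) :
  map_mx (d i) (M *m N) = map_mx (d i) M *m N + M *m map_mx (d i) N.
Proof.
apply/matrixP=> a b; rewrite !mxE der_sum -big_split; apply: eq_bigr => k _.
by rewrite derM !mxE.
Qed.

Lemma dermxD i (m p : nat) (M N : 'M[A]_(m, p)) :
  map_mx (d i) (M + N) = map_mx (d i) M + map_mx (d i) N.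
Proof. by apply/matrixP=> a b; rewrite !mxE derD. Qed.

Lemma dermxN i (m p : nat) (M : 'M[A]_(m, p)) :
  map_mx (d i) (- M) = - map_mx (d i) M.
Proof. by apply/matrixP=> a b; rewrite !mxE derN. Qed.

Lemma dermxC i j (m p : nat) (M : 'M[A]_(m, p)) :
  map_mx (d i) (map_mx (d j) M) = map_mx (d j) (map_mx (d i) M).
Proof. by apply/matrixP=> a b; rewrite !mxE derC. Qed.

End DerivationTheory.

Lemma addmxE (A : pzRingType) m p (M N : 'M[A]_(m, p)) i j :
  (M + N) i j = M i j + N i j.
Proof. by rewrite mxE. Qed.

Lemma oppmxE (A : pzRingType) m p (M : 'M[A]_(m, p)) i j :
  (- M) i j = - M i j.
Proof. by rewrite mxE. Qed.

Lemma zeromxE (A : pzRingType) m p i j : (0 : 'M[A]_(m, p)) i j = 0.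
Proof. by rewrite mxE. Qed.

Lemma trmxD (A : pzRingType) m p (M N : 'M[A]_(m, p)) : (M + N)^T = M^T + N^T.
Proof. exact: linearD. Qed.

Lemma trmxN (A : pzRingType) m p (M : 'M[A]_(m, p)) : (- M)^T = - M^T.
Proof. exact: linearN. Qed.

Lemma mxtraceN (A : pzRingType) m (M : 'M[A]_m) : \tr (- M) = - \tr M.
Proof. exact: raddfN. Qed.

(* Normalizes both sides to sums of words, then compares entries with [ring],
   which treats the words as atoms. *)
Ltac mxring :=
  repeat progress rewrite ?mulmxDl ?mulmxDr ?mulNmx ?mulmxN;
  rewrite ?mulmxA; apply/matrixP => ? ?;
  repeat progress rewrite ?addmxE ?oppmxE ?zeromxE;
  ring.

Section Curvature.
Context {A : comPzRingType} {n : nat} (d : commuting_derivations A n).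
Implicit Types (i j k l m : 'I_n).

Local Notation D i := (map_mx (d i)).

(** * Curvature of a connection and the Bianchi identities *)

Section Connection.
(* [G l i j] is Gamma^l_{ij} *)
Variable G : 'I_n -> 'I_n -> 'I_n -> A.

Definition curv l k i j : A :=
  d i (G l j k) - d j (G l i k)
  + \sum_m (G l i m * G m j k - G l j m * G m i k).

Definition ric i j : A := \sum_l curv l i l j.

Definition cov (T : 'I_n -> 'I_n -> A) i j l : A :=
  d l (T i j) - \sum_m (G m l i * T m j + G m l j * T i m).

Lemma cov_subZ x (T S : 'I_n -> 'I_n -> A) i j l :
  cov (fun i j => T i j - x * S i j) i j l
  = cov T i j l - (d l x * S i j + x * cov S i j l).
Proof.
rewrite /cov derB derM.
have -> : \sum_m (G m l i * (T m j - x * S m j) + G m l j * (T i m - x * S i m))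
  = \sum_m (G m l i * T m j + G m l j * T i m)
    - x * \sum_m (G m l i * S m j + G m l j * S i m).
  by rewrite big_distrr -sumrB; apply: eq_bigr => m _ /=; ring.
ring.
Qed.

(** With the upper index as row, this is the matrix N_i for which the covariant derivative acts on
    columns of vector components as d_i + N_i; the curvature is then the commutator of these
    operators. *)
Definition connmx i : 'M[A]_n := \matrix_(l, k) G l i k.

Definition curvmx i j : 'M[A]_n :=
  D i (connmx j) - D j (connmx i) + connmx i *m connmx j - connmx j *m connmx i.

Lemma curvmxE l k i j : curvmx i j l k = curv l k i j.
Proof.
rewrite /curvmx !mxE /curv sumrB addrA; congr (_ + _ - _);
  by apply: eq_bigr => m _; rewrite !mxE.
Qed.

Lemma curvmx_anti i j : curvmx i j = - curvmx j i.
Proof. rewrite /curvmx; mxring. Qed.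

(** Second Bianchi identity, that is, the Jacobi identity for the operators d_i + N_i: the second
    derivatives cancel because derivations commute, and the remaining products cancel as words. *)
Lemma connmx_bianchi i j k :
  D i (curvmx j k) + connmx i *m curvmx j k - curvmx j k *m connmx i
  + (D j (curvmx k i) + connmx j *m curvmx k i - curvmx k i *m connmx j)
  + (D k (curvmx i j) + connmx k *m curvmx i j - curvmx i j *m connmx k) = 0.
Proof.
rewrite /curvmx !(dermxD, dermxN, dermxM).
rewrite (dermxC _ j i) (dermxC _ k i) (dermxC _ k j); mxring.
Qed.

(** Once the lower indices are put in a common order, both the derivatives and the quadratic terms
    cancel in pairs over the cyclic sum. *)
Lemma curv_bianchi1 l i j k : (forall m i j, G m i j = G m j i) ->
  curv l i j k + curv l j k i + curv l k i j = 0.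
Proof.
move=> Gsym; rewrite /curv.
rewrite !(Gsym l k i) (Gsym l k j) (Gsym l j i).
set S1 := \sum_m _; set S2 := \sum_m _; set S3 := \sum_m _.
have : S1 + S2 + S3 = 0.
  rewrite /S1 /S2 /S3 -!big_split big1 // => m _ /=.
  rewrite !(Gsym _ k i) !(Gsym _ k j) !(Gsym _ j i); ring.
by move=> S0; transitivity (S1 + S2 + S3); first ring.
Qed.


(** The matrix form of [cov], for a tensor with two lower indices. *)
Definition covmx l (T : 'M[A]_n) : 'M[A]_n :=
  D l T - (connmx l)^T *m T - T *m connmx l.

Lemma covmxE l (T : 'I_n -> 'I_n -> A) i j :
  covmx l (\matrix_(a, b) T a b) i j = cov T i j l.
Proof.
rewrite /cov big_split opprD addrA /covmx; rewrite !mxE; congr (_ - _ - _).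
  by apply: eq_bigr => m _; rewrite !mxE.
by apply: eq_bigr => m _; rewrite !mxE mulrC.
Qed.

End Connection.

(** * The Levi-Civita connection of a metric and its Ricci tensor *)

Section LeviCivita.
Context (g h : 'M[A]_n) (half : A).
Hypotheses (gT : g^T = g) (gh1 : g *m h = 1%:M) (halfK : half + half = 1).

Definition levi_civita l i j : A :=
  half * \sum_k h l k * (d i (g k j) + d j (g k i) - d k (g i j)).

Local Notation G := levi_civita.
Local Notation C := (connmx G).
Local Notation Riem := (curvmx G).
Local Notation Ric := (\matrix_(i, j) ric G i j).

Let gC i j : g i j = g j i. Proof. by rewrite -{1}gT mxE. Qed.

Let hg1 : h *m g = 1%:M. Proof. exact: mulmx1C. Qed.

Lemma inv_sym : h^T = h.
Proof.
have : g *m h^T = 1%:M by rewrite -[LHS]trmxK trmx_mul trmxK gT hg1 trmx1.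
by move=> /(congr1 (mulmx h)); rewrite mulmxA hg1 mul1mx mulmx1.
Qed.

Let hC i j : h i j = h j i. Proof. by rewrite -{1}inv_sym mxE. Qed.

Lemma levi_civita_sym l i j : G l i j = G l j i.
Proof.
congr (_ * _); apply: eq_bigr => k _; congr (_ * _).
by rewrite (gC i j) [d i _ + _]addrC.
Qed.

(** Lowering the index cancels [h] against [g] and leaves the Christoffel symbols of the first
    kind. *)
Lemma lower_levi_civita s i j :
  \sum_l g s l * G l i j = half * (d i (g s j) + d j (g s i) - d s (g i j)).
Proof.
pose v := \col_k (d i (g k j) + d j (g k i) - d k (g i j)).
transitivity (half * (g *m (h *m v)) s 0).
  rewrite mxE big_distrr; apply: eq_bigr => l _.
  rewrite mulrCA; congr (_ * (_ * _)); rewrite mxE.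
  by apply: eq_bigr => k _; rewrite [v k 0]mxE.
by rewrite mulmxA gh1 mul1mx mxE.
Qed.

(** Metric compatibility: in the sum of two first-kind symbols all derivatives cancel except two
    equal halves of d_i g. *)
Lemma der_metric i : D i g = (C i)^T *m g + g *m C i.
Proof.
apply/matrixP => a b; rewrite !mxE.
transitivity (\sum_l g b l * G l i a + \sum_l g a l * G l i b); last first.
  congr (_ + _); last by apply: eq_bigr => l _; rewrite !mxE.
  by apply: eq_bigr => l _; rewrite !mxE mulrC gC.
rewrite !lower_levi_civita (gC b a) (gC b i) (gC a i).
rewrite -{1}[d i (g a b)]mul1r -halfK; ring.
Qed.

Lemma covmx_metric l : covmx G l g = 0.
Proof. rewrite /covmx der_metric; mxring. Qed.

Lemma der_inv i : D i h = - (C i *m h) - h *m (C i)^T.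
Proof.
have D1 : D i (1%:M : 'M[A]_n) = 0.
  by apply/matrixP => a b; rewrite !mxE; case: eqP => _; rewrite ?der1 ?der0.
have e0 : D i g *m h + g *m D i h = 0 by rewrite -dermxM gh1.
have -> : D i h = - (h *m D i g *m h).
  rewrite -[LHS]mul1mx -hg1 -!mulmxA -mulmxN; congr (_ *m _).
  by apply/eqP; rewrite -addr_eq0 addrC e0.
rewrite der_metric mulmxDr mulmxDl !mulmxA hg1 mul1mx.
rewrite -[_ *m g *m h]mulmxA gh1 mulmx1; mxring.
Qed.

(** The second derivatives of [h] commute; expanding both orders with [der_inv] leaves R h + h R^T =
    0, the curvature acting on the parallel tensor [h]. *)
Lemma curvmx_skew i j : (Riem i j *m h)^T = - (Riem i j *m h).
Proof.
have := dermxC d i j h; rewrite (der_inv j) (der_inv i).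
rewrite !(dermxD, dermxN, dermxM) (der_inv j) (der_inv i) => E.
apply/eqP; rewrite trmx_mul inv_sym -addr_eq0; apply/eqP.
transitivity (D i (C j) *m h + C j *m (- (C i *m h) - h *m (C i)^T)
    + ((- (C i *m h) - h *m (C i)^T) *m (C j)^T + h *m D i (C j)^T)
  - (D j (C i) *m h + C i *m (- (C j *m h) - h *m (C j)^T)
    + ((- (C j *m h) - h *m (C j)^T) *m (C i)^T + h *m D j (C i)^T))).
  rewrite /curvmx !trmxD !trmxN !trmx_mul -!map_trmx; mxring.
by apply/eqP; rewrite subr_eq0 -eqr_opp !opprD; rewrite !opprD in E; rewrite E.
Qed.

Let eq_oppr0 (x : A) : x = - x -> x = 0.
Proof.
move=> e; rewrite -[x]mul1r -halfK mulrDl -mulrDr {1}e addNr.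
by rewrite mulr0.
Qed.

(** [Riem i j] is the skew matrix [Riem i j *m h] times the symmetric [g], so its trace equals its
    own opposite. *)
Lemma curvmx_trace0 i j : \tr (Riem i j) = 0.
Proof.
have e : Riem i j = Riem i j *m h *m g by rewrite -mulmxA hg1 mulmx1.
apply: eq_oppr0.
by rewrite {1}e -mxtrace_tr trmx_mul curvmx_skew gT mulmxN mxtraceN mxtrace_mulC -e.
Qed.

(** Contract the first Bianchi identity: one of the three terms is a trace of the curvature matrix
    and vanishes, and the other two are Ricci tensors with opposite signs. *)
Lemma ric_sym i j : ric G i j = ric G j i.
Proof.
have : \sum_l curv G l i l j + \sum_l curv G l l j i + \sum_l curv G l j i l = 0.
  rewrite -2!big_split; apply: big1 => l _.
  exact: curv_bianchi1 levi_civita_sym.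
have -> : \sum_l curv G l l j i = 0.
  transitivity (\tr (Riem j i)); last exact: curvmx_trace0.
  by apply: eq_bigr => l _; rewrite curvmxE.
rewrite addr0 => /eqP; rewrite addr_eq0 /ric => /eqP ->; rewrite -sumrN.
by apply: eq_bigr => l _; rewrite -!curvmxE curvmx_anti oppmxE opprK.
Qed.

(** The metric trace commutes with the covariant derivative: the derivative of [h] supplies exactly
    the connection terms of [covmx], by cyclicity of the trace. *)
Lemma der_trace_inv m (T : 'M[A]_n) :
  d m (\sum_i \sum_j h i j * T i j) = \sum_i \sum_j h i j * covmx G m T i j.
Proof.
have trE (S : 'M[A]_n) : \sum_i \sum_j h i j * S i j = \tr (h *m S).
  rewrite exchange_big; apply: eq_bigr => j _; rewrite mxE; apply: eq_bigr => i _.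
  by rewrite hC.
rewrite !trE; transitivity (\tr (D m (h *m T))).
  by rewrite /mxtrace der_sum; apply: eq_bigr => i _; rewrite [RHS]mxE.
rewrite dermxM der_inv /covmx !mulmxDr !mulmxDl !mulmxN !mulNmx !mxtraceD !mxtraceN.
rewrite -[C m *m h *m T]mulmxA [\tr (C m *m _)]mxtrace_mulC !mulmxA; ring.
Qed.

(** Since [h] is parallel, the divergence of [T] is that of the mixed tensor [h *m T], expanded here
    into its Christoffel terms. *)
Lemma divergence_inv j (T : 'M[A]_n) :
  \sum_l \sum_i h l i * covmx G l T i j
  = \sum_l d l ((h *m T) l j) + \sum_l \sum_p G l l p * (h *m T) p j
    - \sum_l \sum_p (h *m T) l p * G p l j.
Proof.
rewrite -big_split -sumrB; apply: eq_bigr => l _ /=.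
transitivity ((D l (h *m T) + C l *m (h *m T) - h *m T *m C l) l j).
  transitivity ((h *m covmx G l T) l j); first by rewrite [RHS]mxE.
  congr (fun M : 'M[A]_n => M l j); rewrite dermxM der_inv /covmx; mxring.
rewrite !addmxE oppmxE [D l _ l j]mxE [(C l *m _) l j]mxE [(_ *m C l) l j]mxE.
by congr (_ + _ - _); apply: eq_bigr => p _; rewrite [C l _ _]mxE.
Qed.

Definition scalar_curv : A := \sum_i \sum_j h i j * ric G i j.

(** [P i j] is the curvature with both matrix indices raised. [X i] is the covariant derivative on
    these two upper indices only; the indices [i], [j] of [P] receive no Christoffel correction. *)
Let P i j := Riem i j *m h.
Let X i (T : 'M[A]_n) := D i T + C i *m T + T *m (C i)^T.

Let XP_bianchi i j k : X i (P j k) + X j (P k i) + X k (P i j) = 0.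
Proof.
transitivity ((D i (Riem j k) + C i *m Riem j k - Riem j k *m C i
  + (D j (Riem k i) + C j *m Riem k i - Riem k i *m C j)
  + (D k (Riem i j) + C k *m Riem i j - Riem i j *m C k)) *m h).
  rewrite /X /P !dermxM !der_inv; move: (Riem i j) (Riem j k) (Riem k i) => *; mxring.
by rewrite connmx_bianchi mul0mx.
Qed.

Let P_anti i j k l : P i j l k = - P j i l k.
Proof. by rewrite /P curvmx_anti mulNmx oppmxE. Qed.

Let P_skew i j k l : P i j l k = - P i j k l.
Proof.
by have := congr1 (fun M : 'M[A]_n => M k l) (curvmx_skew i j); rewrite mxE oppmxE.
Qed.

(** The mixed Ricci tensor, a contraction of [P] by [QE]. *)
Let Q := h *m Ric.

Let QE k j : \sum_l P l j l k = Q k j.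
Proof.
rewrite mxE; under eq_bigr do rewrite mxE.
rewrite exchange_big; apply: eq_bigr => p _.
rewrite mxE /ric big_distrr; apply: eq_bigr => l _ /=.
by rewrite hC mulrC curvmxE.
Qed.

Let X_tr i T : X i T^T = (X i T)^T.
Proof. by rewrite /X !trmxD !trmx_mul trmxK map_trmx addrAC. Qed.

Let XE i T l k :
  X i T l k = d i (T l k) + \sum_p G l i p * T p k + \sum_p T l p * G k i p.
Proof.
rewrite !addmxE [D i T l k]mxE [(C i *m _) l k]mxE [(_ *m (C i)^T) l k]mxE.
by congr (_ + _ + _); apply: eq_bigr => p _; rewrite !mxE.
Qed.

(** The full contraction of [P] is the scalar curvature. As [X] leaves two indices uncorrected, two
    equal Christoffel terms survive; they complete the divergence in [contracted_bianchi]. *)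
Let sum_X_first j : \sum_l \sum_k X j (P l k) l k
  = d j scalar_curv + (\sum_l \sum_p Q l p * G p l j) *+ 2.
Proof.
under eq_bigr do under eq_bigr do rewrite XE.
under eq_bigr do rewrite !big_split /=.
rewrite !big_split /= -addrA mulr2n; congr (_ + (_ + _)).
- transitivity (d j (\sum_k Q k k)).
    rewrite exchange_big der_sum; apply: eq_bigr => k _.
    by rewrite -QE der_sum.
  congr (d j _); apply: eq_bigr => k _; rewrite mxE; apply: eq_bigr => p _.
  by rewrite mxE ric_sym.
- rewrite [RHS]exchange_big; apply: eq_bigr => l _; rewrite exchange_big.
  apply: eq_bigr => p _ /=; rewrite -big_distrr /= levi_civita_sym mulrC -QE.
  by congr (_ * _); apply: eq_bigr => k _; rewrite P_anti P_skew opprK.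
- rewrite exchange_big [RHS]exchange_big; apply: eq_bigr => k _; rewrite exchange_big.
  apply: eq_bigr => p _ /=; rewrite -big_distrl /= levi_civita_sym -QE.
  by congr (_ * _); apply: eq_bigr => l _; rewrite P_skew.
Qed.

Let sum_X_second j : \sum_l \sum_k X l (P k j) l k
  = - (\sum_l d l (Q l j) + \sum_l \sum_p G l l p * Q p j).
Proof.
under eq_bigr do under eq_bigr do rewrite XE.
under eq_bigr do rewrite !big_split /=.
rewrite !big_split /= [X in _ + X = _](_ : _ = 0).
  rewrite addr0 opprD -!sumrN; congr (_ + _); apply: eq_bigr => l _.
    rewrite -QE der_sum -sumrN; apply: eq_bigr => k _.
    by rewrite -derN -P_skew.
  rewrite exchange_big -sumrN; apply: eq_bigr => p _ /=.
  rewrite -big_distrr /= -mulrN -QE -sumrN; congr (_ * _).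
  by apply: eq_bigr => k _; exact: P_skew.
(* For each [k] the sum pairs [P k j], skew in its matrix indices, with [G k l p], symmetric in [l]
   and [p]. *)
rewrite exchange_big big1 // => k _; apply: eq_oppr0.
rewrite {1}exchange_big -sumrN; apply: eq_bigr => l _; rewrite -sumrN.
by apply: eq_bigr => p _; rewrite P_skew mulNr levi_civita_sym.
Qed.

(** Contract the second Bianchi identity twice: the first cyclic term gives the derivative of the
    scalar curvature, the other two each give minus a divergence of [Q], up to Christoffel terms
    that add up to [divergence_inv]. *)
Lemma contracted_bianchi j :
  d j scalar_curv = (\sum_l \sum_i h l i * cov G (ric G) i j l) *+ 2.
Proof.
have : \sum_l \sum_k X j (P l k) l k + \sum_l \sum_k X l (P k j) l k
       + \sum_l \sum_k X k (P j l) l k = 0.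
  rewrite -2!big_split; apply: big1 => l _; rewrite -2!big_split.
  apply: big1 => k _; transitivity ((0 : 'M[A]_n) l k); last exact: zeromxE.
  by rewrite -(XP_bianchi j l k) !addmxE.
(* The third cyclic term equals the second after exchanging [l] and [k], because [P j l] is the
   transpose of [P l j]. *)
rewrite [X in _ + _ + X](_ : _ = \sum_l \sum_k X l (P k j) l k).
  rewrite sum_X_first sum_X_second => e.
  transitivity ((\sum_l \sum_i h l i * covmx G l Ric i j) *+ 2); last first.
    congr (_ *+ 2); apply: eq_bigr => l _; apply: eq_bigr => i _.
    by rewrite covmxE.
  rewrite divergence_inv -/Q; apply: subr0_eq; apply: etrans e; ring.
rewrite exchange_big; apply: eq_bigr => k _; apply: eq_bigr => l _ /=.
transitivity ((X k (P l j))^T l k); last by rewrite mxE.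
rewrite -X_tr; congr (X _ _ _ _); apply/matrixP => a b.
by rewrite [RHS]mxE P_anti -P_skew.
Qed.

(** The metric is parallel and [c] is constant, so only the scalar curvature gets differentiated.
    With c = 1/(2n-2) the shifted tensor is the Schouten tensor. *)
Lemma cov_shifted (c : A) i j l : (forall m, d m c = 0) ->
  cov G (fun i j => ric G i j - scalar_curv * c * g i j) i j l
  = cov G (ric G) i j l - d l scalar_curv * c * g i j.
Proof.
move=> dc0; rewrite cov_subZ derM dc0.
have -> : cov G (fun i j => g i j) i j l = 0; last by ring.
rewrite -covmxE (_ : \matrix_(_, _) _ = g) ?covmx_metric ?zeromxE//.
by apply/matrixP => ? ?; rewrite mxE.
Qed.

(** Koszul's argument: compatibility writes each derivative of [g] as a sum of two lowered symbols
    [L], and the symmetry of [E] isolates twice [L s i j] from the three permuted derivatives. The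
    index is raised again with [h]. *)
Lemma levi_civita_unique (E : 'I_n -> 'I_n -> 'I_n -> A) :
  (forall l i j, E l i j = E l j i) ->
  (forall i, D i g = (connmx E i)^T *m g + g *m connmx E i) ->
  forall l i j, E l i j = G l i j.
Proof.
move=> Esym Eg; pose L s i j := \sum_l g s l * E l i j.
have dg i a b : d i (g a b) = L b i a + L a i b.
  have := congr1 (fun M : 'M[A]_n => M a b) (Eg i); rewrite !mxE => ->.
  congr (_ + _); apply: eq_bigr => l _; rewrite !mxE //.
  by rewrite mulrC gC.
have Lsym s i j : L s i j = L s j i by apply: eq_bigr => l _; rewrite Esym.
have LE s i j : L s i j = \sum_l g s l * G l i j.
  rewrite lower_levi_civita !dg (Lsym i j s) (Lsym j i s) (Lsym s j i).
  transitivity ((half + half) * L s i j); first by rewrite halfK mul1r.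
  ring.
have lift_inv (F : 'I_n -> 'I_n -> 'I_n -> A) l i j :
    F l i j = \sum_s h l s * \sum_m g s m * F m i j.
  transitivity ((h *m (g *m \col_m F m i j)) l 0).
    by rewrite mulmxA hg1 mul1mx mxE.
  rewrite mxE; apply: eq_bigr => s _; congr (_ * _); rewrite mxE.
  by apply: eq_bigr => m _; rewrite mxE.
move=> l i j; rewrite (lift_inv E) (lift_inv G).
by apply: eq_bigr => s _; congr (_ * _); exact: LE.
Qed.

End LeviCivita.
End Curvature.

(** * Transformation of connection, curvature and scalar curvature under a change of coordinates *)

Section ChangeOfCoordinates.
Context {A A' : comPzRingType} {n : nat}.
Context (d : commuting_derivations A n) (d' : commuting_derivations A' n).
Context (psi : {rmorphism A' -> A}) (J : 'M[A]_n).
(** [psi] models the pullback of functions along the transition map and [J] its Jacobian; [chain] is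
    the chain rule and [J_closed] the symmetry of the second derivatives of the transition map. *)
Hypothesis chain : forall i f, d i (psi f) = \sum_k J i k * psi (d' k f).
Hypothesis J_closed : forall i j k, d i (J j k) = d j (J i k).
Context (g h : 'M[A]_n) (half : A) (g' h' : 'M[A']_n) (half' : A').
Hypotheses (gT : g^T = g) (gh1 : g *m h = 1%:M) (halfK : half + half = 1).
Hypotheses (gT' : g'^T = g') (gh1' : g' *m h' = 1%:M)
  (halfK' : half' + half' = 1).
Hypothesis g_change : g = J *m map_mx psi g' *m J^T.

Local Notation D i := (map_mx (d i)).
Local Notation G := (levi_civita d g h half).
Local Notation G' := (levi_civita d' g' h' half').

Let gbar := map_mx psi g'.
(** The inverse Jacobian, read off from J gbar J^T h = g h = 1. *)
Let K := gbar *m J^T *m h.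

Let JK : J *m K = 1%:M.
Proof. by rewrite /K !mulmxA -g_change. Qed.

Let KJ : K *m J = 1%:M.
Proof. exact: mulmx1C. Qed.

Lemma inv_change : map_mx psi h' = J^T *m h *m J.
Proof.
have hg1' : map_mx psi h' *m gbar = 1%:M.
  by rewrite -map_mxM (mulmx1C gh1') map_mx1.
by rewrite -[LHS]mulmx1 -KJ /K !mulmxA hg1' mul1mx.
Qed.

(* The connection matrices of the second chart, pulled back as a one-form. *)
Let Theta i : 'M[A]_n := \sum_b J i b *: (map_mx psi (connmx G' b))^T.

Let ThetaE i e a : Theta i e a = \sum_b J i b * psi (G' a b e).
Proof. by rewrite summxE; apply: eq_bigr => b _; rewrite !mxE. Qed.

Let der_gbar i : D i gbar = Theta i *m gbar + gbar *m (Theta i)^T.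
Proof.
have -> : D i gbar = \sum_b J i b *: map_mx psi (map_mx (d' b) g').
  apply/matrixP => x y; rewrite !mxE chain summxE.
  by apply: eq_bigr => b _; rewrite !mxE.
rewrite /Theta linear_sum /= mulmx_suml mulmx_sumr -big_split.
apply: eq_bigr => b _ /=; rewrite linearZ /= trmxK -scalemxAl -scalemxAr -scalerDr.
by rewrite (der_metric d' gT' gh1' halfK') map_mxD !map_mxM map_trmx.
Qed.

Let pulled i : 'M[A]_n := (D i J + J *m Theta i) *m K.

(** By uniqueness of the Levi-Civita connection it suffices that [pulled] is symmetric, which
    follows from [J_closed] and the symmetry of the second connection, and metric, which follows by
    differentiating g = J gbar J^T. *)
Lemma connmx_change i : (connmx G i)^T *m J = D i J + J *m Theta i.
Proof.
suff -> : (connmx G i)^T = pulled i by rewrite /pulled -mulmxA KJ mulmx1.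
apply/matrixP => k l; rewrite [LHS]mxE [LHS]mxE; apply/esym.
apply: (@levi_civita_unique _ _ d g h half gT gh1 halfK (fun l i k => pulled i k l)).
  move=> {}l {}i j; rewrite !mxE; apply: eq_bigr => a _; congr (_ * _).
  rewrite !mxE J_closed; congr (_ + _).
  under eq_bigr do rewrite ThetaE big_distrr.
  under [RHS]eq_bigr do rewrite ThetaE big_distrr.
  rewrite exchange_big; apply: eq_bigr => b _; apply: eq_bigr => c _ /=.
  by rewrite levi_civita_sym //; ring.
move=> {k l}i; have -> : connmx (fun l i k => pulled i k l) i = (pulled i)^T.
  by apply/matrixP => l k; rewrite !mxE.
have e : pulled i *m g = (D i J + J *m Theta i) *m gbar *m J^T.
  rewrite g_change /pulled -[J *m _ *m _]mulmxA -[X in X = _]mulmxA.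
  by rewrite [K *m _]mulmxA KJ mul1mx !mulmxA.
have -> : g *m (pulled i)^T = (pulled i *m g)^T by rewrite [RHS]trmx_mul gT.
rewrite trmxK e.
have gbarT : gbar^T = gbar by rewrite /gbar map_trmx gT'.
rewrite g_change -/gbar !dermxM der_gbar !trmx_mul trmxK gbarT trmxD trmx_mul.
rewrite map_trmx; mxring.
Qed.

Let sum_swap i j (F : 'I_n -> 'I_n -> A) :
  \sum_b \sum_c J j b * J i c * F b c = \sum_b \sum_c J i b * J j c * F c b.
Proof.
rewrite exchange_big; apply: eq_bigr => b _; apply: eq_bigr => c _.
by rewrite [J j c * _]mulrC.
Qed.

(** The curvature of the pulled-back connection form is the pullback of the curvature: the terms
    with derivatives of [J] cancel by [J_closed]. The products appear in reversed order because
    [Theta] is transposed. *)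
Let curv_Theta i j :
  D i (Theta j) - D j (Theta i) + Theta j *m Theta i - Theta i *m Theta j
  = \sum_b \sum_c (J i b * J j c) *: (map_mx psi (curvmx d' G' b c))^T.
Proof.
have dTheta i' j' e a : D i' (Theta j') e a =
    \sum_c d i' (J j' c) * psi (G' a c e)
    + \sum_b \sum_c J i' b * J j' c * psi (d' b (G' a c e)).
  rewrite mxE ThetaE der_sum [X in _ = _ + X]exchange_big -big_split.
  apply: eq_bigr => c _ /=.
  rewrite derM chain big_distrr; congr (_ + _); apply: eq_bigr => b _ /=.
  by rewrite mulrA [J j' c * _]mulrC.
have Theta2 i' j' e a : (Theta i' *m Theta j') e a =
    \sum_b \sum_c J i' b * J j' c * psi (\sum_m G' a c m * G' m b e).
  rewrite mxE; under eq_bigr do rewrite !ThetaE big_distrl.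
  rewrite exchange_big; apply: eq_bigr => b _ /=.
  under eq_bigr do rewrite big_distrr.
  rewrite exchange_big; apply: eq_bigr => c _ /=.
  rewrite rmorph_sum big_distrr; apply: eq_bigr => m _ /=.
  by rewrite rmorphM; ring.
apply/matrixP => e a; rewrite !addmxE !oppmxE !dTheta !Theta2 summxE.
have -> : \sum_c d j (J i c) * psi (G' a c e) = \sum_c d i (J j c) * psi (G' a c e).
  by apply: eq_bigr => c _; rewrite J_closed.
rewrite (sum_swap i j (fun b c => psi (d' b (G' a c e)))).
rewrite (sum_swap i j (fun b c => psi (\sum_m G' a c m * G' m b e))).
rewrite opprD addrACA subrr add0r -!sumrB -!big_split -!sumrB.
apply: eq_bigr => b _; rewrite summxE -!sumrB -!big_split -!sumrB.
apply: eq_bigr => c _; rewrite mxE mxE [map_mx _ _ _ _]mxE curvmxE /curv sumrB.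
by rewrite !(rmorphD, rmorphN) /=; ring.
Qed.

(** Differentiate [connmx_change] once more and antisymmetrize: the second derivatives of [J] and
    the mixed terms cancel, which leaves [J] times the curvature of [Theta]. *)
Lemma curvmx_change i j : (curvmx d G i j)^T *m J
  = J *m \sum_b \sum_c (J i b * J j c) *: (map_mx psi (curvmx d' G' b c))^T.
Proof.
rewrite -curv_Theta; have E := connmx_change.
have DE k l : D k (connmx G l)^T *m J = D k (D l J) + D k J *m Theta l
    + J *m D k (Theta l) - (connmx G l)^T *m D k J.
  have := congr1 (map_mx (d k)) (E l); rewrite dermxD !dermxM addrA => <-.
  by rewrite addrK.
rewrite /curvmx !trmxD !trmxN !trmx_mul !map_trmx !mulmxDl !mulNmx !DE.
rewrite -![_ *m _ *m J]mulmxA !E (dermxC _ j i) !mulmxDr !mulmxA !E.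
mxring.
Qed.

(** Solving [curvmx_change] for the curvature puts [K] on the right; the Ricci trace contracts this
    [K] with one Jacobian factor, and two factors of [J] remain. *)
Lemma ric_change k j :
  ric d G k j = \sum_e \sum_c J k e * J j c * psi (ric d' G' e c).
Proof.
pose F b c := (map_mx psi (curvmx d' G' b c))^T.
transitivity (\sum_l \sum_b \sum_c J l b * J j c * (J *m F b c *m K) k l).
  apply: eq_bigr => l _; rewrite -curvmxE.
  transitivity (((curvmx d G l j)^T *m J *m K) k l).
    by rewrite -mulmxA JK mulmx1 [RHS]mxE.
  rewrite curvmx_change mulmx_sumr mulmx_suml summxE; apply: eq_bigr => b _.
  rewrite mulmx_sumr mulmx_suml summxE; apply: eq_bigr => c _.
  by rewrite -scalemxAr -scalemxAl mxE.
transitivity (\sum_b \sum_c \sum_e J j c * (J k e * psi (curv d' G' b e b c))).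
  rewrite exchange_big; apply: eq_bigr => b _.
  rewrite exchange_big; apply: eq_bigr => c _ /=.
  transitivity (J j c * (J *m F b c *m K *m J) k b).
    rewrite [(_ *m J) k b]mxE big_distrr; apply: eq_bigr => l _ /=; ring.
  rewrite -mulmxA KJ mulmx1 mxE big_distrr; apply: eq_bigr => e _ /=.
  by rewrite mxE [map_mx _ _ _ _]mxE curvmxE.
rewrite exchange_big [RHS]exchange_big; apply: eq_bigr => c _ /=.
rewrite exchange_big; apply: eq_bigr => e _ /=.
rewrite rmorph_sum big_distrr; apply: eq_bigr => b _ /=; ring.
Qed.

(** Write the scalar curvature as the trace of [h] times Ricci and move one Jacobian around
    cyclically; J^T h J is the pullback of [h']. *)
Lemma scalar_curv_change :
  scalar_curv d g h half = psi (scalar_curv d' g' h' half').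
Proof.
pose M := \matrix_(i, j) ric d' G' i j.
have Ric : \matrix_(i, j) ric d G i j = J *m map_mx psi M *m J^T.
  apply/matrixP => k j; rewrite mxE ric_change exchange_big mxE.
  apply: eq_bigr => c _; rewrite mxE big_distrl; apply: eq_bigr => e _.
  by rewrite !mxE /= mulrAC.
transitivity (\tr (h *m (\matrix_(i, j) ric d G i j)^T)).
  by apply: eq_bigr => i _; rewrite mxE; apply: eq_bigr => j _; rewrite !mxE.
rewrite Ric !trmx_mul trmxK !mulmxA mxtrace_mulC !mulmxA -inv_change.
rewrite /mxtrace rmorph_sum; apply: eq_bigr => i _.
rewrite mxE rmorph_sum; apply: eq_bigr => j _.
by rewrite !mxE rmorphM.
Qed.

End ChangeOfCoordinates.

(** * Mean values, Schwarz and the chain rule *)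

Section MeanValue.
Context {R : realType} {n : nat}.
Implicit Types (f : 'rV[R]_n -> R) (x y v : 'rV[R]_n) (t : R).

Let line_quotient f x v t :
  (fun h : R => h^-1 *: (((fun s : R => f (s *: v + x)) \o shift t) (h *: (1 : R))
     - f (t *: v + x)))
  = (fun h : R => h^-1 *: ((f \o shift (t *: v + x)) (h *: v) - f (t *: v + x))).
Proof.
apply/funext => h /=; congr (_ *: (f _ - _)).
by rewrite /= [h *: 1]mulr1 scalerDl addrA.
Qed.

Lemma is_derive_line f x v t : derivable f (t *: v + x) v ->
  is_derive t (1 : R) (fun s => f (s *: v + x)) ('D_v f (t *: v + x)).
Proof.
move=> fv; apply: DeriveDef.
  by move: fv; rewrite /derivable -line_quotient.
by rewrite /derive -line_quotient.
Qed.

Lemma mean_value_line f x v t :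
  (forall s, `|s| <= `|t| -> derivable f (s *: v + x) v) ->
  exists2 s, `|s| <= `|t| & f (t *: v + x) - f x = t * 'D_v f (s *: v + x).
Proof.
move=> fv; pose F (s : R) := f (s *: v + x).
have F0 : F 0 = f x by rewrite /F scale0r add0r.
have dF s : `|s| <= `|t| -> is_derive s (1 : R) F ('D_v f (s *: v + x)).
  by move=> /fv; exact: is_derive_line.
have [t0|t0] := leP 0 t.
  have le_t s : s \in `[0, t] -> `|s| <= `|t|.
    by rewrite in_itv /= => /andP[s0 st]; rewrite !ger0_norm.
  have [| |s s0t Fs] := @MVT_segment R F (fun s => 'D_v f (s *: v + x)) 0 t t0.
  - by move=> s s0t; apply: dF; apply: le_t; apply: subset_itvW s0t.
  - by apply: derivable_within_continuous => s /le_t /dF [].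
  - by exists s; [exact: le_t | rewrite -F0 -/(F t) Fs subr0 mulrC].
have le_t s : s \in `[t, 0] -> `|s| <= `|t|.
  by rewrite in_itv /= => /andP[ts s0]; rewrite !ler0_norm ?lerN2// ltW.
have [| |s s0t Fs] := @MVT_segment R F (fun s => 'D_v f (s *: v + x)) t 0 (ltW t0).
- by move=> s s0t; apply: dF; apply: le_t; apply: subset_itvW s0t.
- by apply: derivable_within_continuous => s /le_t /dF [].
- exists s; first exact: le_t.
  by rewrite -F0 -/(F t) -opprB Fs sub0r mulrN opprK mulrC.
Qed.

Lemma mx_norm_le x (e : R) : 0 <= e -> (forall k, `|x 0 k| <= e) -> `|x| <= e.
Proof.
move=> e0 xe; rewrite [leLHS]/Num.Def.normr /= mx_normrE.
by apply: bigmax_le => // -[i k] _ /=; rewrite ord1.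
Qed.

Lemma coord_le_norm x k : `|x 0 k| <= `|x|.
Proof.
rewrite [leRHS]/Num.Def.normr /= mx_normrE.
exact: (le_bigmax _ (fun i : 'I_1 * 'I_n => `|x i.1 i.2|) (0, k)).
Qed.

(* Moves from [y] to [y + h] one coordinate at a time. *)
Lemma mean_value_box f y h (r : R) : `|h| < r ->
  (forall x, `|x - y| < r -> forall k, derivable f x (delta_mx 0 k)) ->
  exists xi : 'I_n -> 'rV[R]_n,
    (forall k, `|xi k - y| <= `|h|) /\
    f (y + h) - f y = \sum_k h 0 k * pderiv k f (xi k).
Proof.
move=> hr df.
pose p (m : nat) : 'rV[R]_n := \row_k (y 0 k + if (k < m)%N then h 0 k else 0).
have pS (m : 'I_n) : p m.+1 = h 0 m *: delta_mx 0 m + p m.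
  apply/rowP => k; rewrite !mxE /= ltnS leq_eqVlt [k == m]eq_sym.
  have [->|mk] := eqVneq m k; first by rewrite !eqxx ltnn mulr1 addr0 addrC.
  by rewrite (inj_eq val_inj) eq_sym (negPf mk) mulr0 add0r.
have near_p (m : 'I_n) s : `|s| <= `|h 0 m| -> `|s *: delta_mx 0 m + p m - y| <= `|h|.
  move=> sh; apply: mx_norm_le => // k; rewrite !mxE /= [k == m]eq_sym.
  have [<-|mk] := eqVneq m k.
    by rewrite ltnn mulr1 addr0 addrK (le_trans sh)// coord_le_norm.
  rewrite mulr0 add0r addrAC subrr add0r.
  by case: ifP => _; rewrite ?normr0 ?coord_le_norm.
have step (m : 'I_n) : exists z, `|z - y| <= `|h| /\
    f (p m.+1) - f (p m) = h 0 m * pderiv m f z.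
  rewrite pS; have [|s sh ->] := @mean_value_line f (p m) (delta_mx 0 m) (h 0 m).
    by move=> s sh; apply: df; apply: le_lt_trans hr; exact: near_p.
  by exists (s *: delta_mx 0 m + p m); split=> //; exact: near_p.
have [xi xiP] := choice step.
exists xi; split=> [k|]; first by have [] := xiP k.
have -> : y + h = p n by apply/rowP => k; rewrite !mxE ltn_ord.
have -> : f y = f (p 0) by congr f; apply/rowP => k; rewrite !mxE ltn0 addr0.
rewrite -(telescope_sumr (f \o p)) // big_mkord.
by apply: eq_bigr => k _; have [] := xiP k.
Qed.

End MeanValue.

(** * Symmetry of second partial derivatives *)

Section SecondDerivatives.
Context {R : realType} {n : nat}.
Implicit Types (f : 'rV[R]_n -> R) (x y v : 'rV[R]_n) (t : R) (i j : 'I_n).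

Let shift_quotient f x y v :
  (fun h : R => h^-1 *: (((fun z => f (y + z)) \o shift x) (h *: v) - f (y + x)))
  = (fun h : R => h^-1 *: ((f \o shift (y + x)) (h *: v) - f (y + x))).
Proof. by apply/funext => h /=; rewrite addrCA. Qed.

Let derivable_shift f x y v :
  derivable f (y + x) v -> derivable (fun z => f (y + z)) x v.
Proof. by rewrite /derivable shift_quotient. Qed.

Let derive_shift f x y v : 'D_v (fun z => f (y + z)) x = 'D_v f (y + x).
Proof. by rewrite /derive shift_quotient. Qed.

Let norm_delta i : `|delta_mx 0 i : 'rV[R]_n| <= 1.
Proof.
apply: mx_norm_le => // k; rewrite !mxE.
by case: (_ && _); rewrite ?normr1 ?normr0.
Qed.

(** Two mean values: first along direction [i] for the increment [w] of [f] in direction [j], then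
    along [j] for [pderiv i f]. *)
Lemma second_difference f x i j (r t : R) : `|t| *+ 2 < r ->
  (forall y, `|y - x| < r -> forall k, derivable f y (delta_mx 0 k)) ->
  (forall y, `|y - x| < r -> forall k, derivable (pderiv i f) y (delta_mx 0 k)) ->
  exists2 xi, `|xi - x| <= `|t| *+ 2 &
    f (t *: delta_mx 0 j + (t *: delta_mx 0 i + x)) - f (t *: delta_mx 0 i + x)
    - (f (t *: delta_mx 0 j + x) - f x) = t * (t * pderiv j (pderiv i f) xi).
Proof.
move=> tr df ddf; pose ei : 'rV[R]_n := delta_mx 0 i; pose ej : 'rV[R]_n := delta_mx 0 j.
have near2 s s' : `|s| <= `|t| -> `|s'| <= `|t| ->
    `|s' *: ej + (s *: ei + x) - x| <= `|t| *+ 2.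
  move=> st s't; rewrite addrA addrK (le_trans (ler_normD _ _))//.
  rewrite mulr2n; apply: lerD; rewrite normrZ.
    by apply: le_trans s't; rewrite ler_piMr ?norm_delta.
  by apply: le_trans st; rewrite ler_piMr ?norm_delta.
have near1 s : `|s| <= `|t| -> `|s *: ei + x - x| < r.
  move=> st; apply: le_lt_trans tr; have := near2 s 0 st.
  by rewrite scale0r add0r normr0; exact.
have near2' s s' : `|s| <= `|t| -> `|s'| <= `|t| -> `|s' *: ej + (s *: ei + x) - x| < r.
  by move=> st s't; apply: le_lt_trans tr; exact: near2.
pose w z := f (t *: ej + z) - f z.
have [s st|s st] := @mean_value_line R n w x ei t.
  apply: derivableB; last exact/df/near1.
  by apply: derivable_shift; apply/df/near2'.
rewrite /w => ->; rewrite deriveB; last first.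
- exact/df/near1.
- by apply: derivable_shift; apply/df/near2'.
rewrite derive_shift -/(pderiv i f _) -/(pderiv i f _).
have [s' s't|s' s't ->] := @mean_value_line R n (pderiv i f) (s *: ei + x) ej t.
  exact/ddf/near2'.
by exists (s' *: ej + (s *: ei + x)) => //; exact: near2.
Qed.

Let close (e a b c : R) :
  `|b - c| < e / 2 -> `|a - c| < e / 2 -> `|a - b| <= e.
Proof.
rewrite !ltr_norml ler_norml => /andP[? ?] /andP[? ?].
by apply/andP; split; lra.
Qed.

(** The same second difference yields both mixed derivatives, at two points within [2 t] of [x];
    continuity at [x] then makes their values there arbitrarily close. *)
Lemma pderivC f x i j (r : R) : 0 < r ->
  (forall y, `|y - x| < r -> forall k, derivable f y (delta_mx 0 k)) ->
  (forall y, `|y - x| < r -> forall l k, derivable (pderiv l f) y (delta_mx 0 k)) ->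
  (forall k l, {for x, continuous (pderiv k (pderiv l f))}) ->
  pderiv i (pderiv j f) x = pderiv j (pderiv i f) x.
Proof.
move=> r0 df ddf cf; apply/eqP; rewrite -subr_eq0 -normr_le0; apply/ler_addgt0Pr => e e0.
rewrite add0r.
have e2 : 0 < e / 2 by rewrite divr_gt0.
have near_x k l : \forall y \near x, `|pderiv k (pderiv l f) x - pderiv k (pderiv l f) y| < e / 2.
  by have /cvgrPdist_lt := cf k l; exact.
have /nbhs_ballP[d /= d0 dP] : \forall y \near x,
    `|pderiv i (pderiv j f) x - pderiv i (pderiv j f) y| < e / 2 /\
    `|pderiv j (pderiv i f) x - pderiv j (pderiv i f) y| < e / 2.
  exact: filterI (near_x i j) (near_x j i).
pose m := Num.min d r; have m0 : 0 < m by rewrite lt_min d0 r0.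
pose t := m / 4; have t0 : 0 < t by rewrite divr_gt0.
have tm : `|t| *+ 2 < m by rewrite gtr0_norm// /t; lra.
have [tr td] : `|t| *+ 2 < r /\ `|t| *+ 2 < d.
  by split; apply: lt_le_trans tm _; rewrite ge_min lexx ?orbT.
have [xi xi_x E] := second_difference j tr df (fun y yr => ddf y yr i).
have [eta eta_x E'] := second_difference i tr df (fun y yr => ddf y yr j).
have xd z : `|z - x| <= `|t| *+ 2 -> ball x d z.
  by move=> zx; rewrite mx_norm_ball /ball_ /= distrC (le_lt_trans zx).
have [_ A] := dP _ (xd _ xi_x); have [B _] := dP _ (xd _ eta_x).
have eq_xi : pderiv j (pderiv i f) xi = pderiv i (pderiv j f) eta.
  apply: (@mulfI _ t); first by rewrite gt_eqF.
  apply: (@mulfI _ t); first by rewrite gt_eqF.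
  have swap (a b c d' : R) : a - b - (c - d') = a - c - (b - d') by ring.
  apply: etrans (esym E) _; apply: etrans _ E'.
  rewrite (addrCA (t *: delta_mx 0 i) (t *: delta_mx 0 j) x).
  exact: swap.
by rewrite eq_xi in A; exact: close A B.
Qed.

End SecondDerivatives.

(** * The chain rule for continuous partial derivatives *)

Section ChainRule.
Context {R : realType} {m n : nat}.
Implicit Types (phi : 'rV[R]_m -> 'rV[R]_n) (f : 'rV[R]_n -> R).

(** [mean_value_box] writes the increment of [f] as the coordinate increments of [phi] times partial
    derivatives at points [xi]; these points tend to [phi x], where the partial derivatives are
    continuous. *)
Lemma is_derive_comp phi f (x v : 'rV[R]_m) (r : R) : 0 < r ->
  (forall k, derivable (fun z => phi z 0 k) x v) ->
  (forall y, `|y - phi x| < r -> forall k, derivable f y (delta_mx 0 k)) ->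
  (forall k, {for phi x, continuous (pderiv k f)}) ->
  is_derive x v (f \o phi)
    (\sum_k 'D_v (fun z => phi z 0 k) x * pderiv k f (phi x)).
Proof.
move=> r0 dphi df cf.
pose h (t : R) := phi (t *: v + x) - phi x.
pose q k (t : R) := t^-1 * h t 0 k.
have q_cvg k : q k @ 0^' --> 'D_v (fun z => phi z 0 k) x.
  have := dphi k; rewrite /derivable /derive => /cvg_ex[l ql].
  rewrite (cvg_lim _ ql)//; suff -> : q k = (fun t => t^-1 *:
    (((fun z => phi z 0 k) \o shift x) (t *: v) - phi x 0 k)) by [].
  by apply/funext => t; rewrite /q /h !mxE.
have h_small (e : R) : 0 < e -> \forall t \near 0^', `|h t| < e.
  move=> e0.
  have e2 : 0 < e / 2 by rewrite divr_gt0.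
  have : \forall t \near 0^', forall k, `|h t 0 k| <= e / 2.
    apply: filter_forall => k.
    have : (fun t => t * q k t) @ 0^' --> 0 * 'D_v (fun z => phi z 0 k) x.
      by apply: cvgM (q_cvg k); apply: cvg_within.
    rewrite mul0r => /cvgrPdist_le /(_ _ e2) hk.
    near=> t; have t0 : t != 0 by near: t; exact: nbhs_dnbhs_neq.
    have : `|0 - t * q k t| <= e / 2 by near: t; exact: hk.
    by rewrite sub0r normrN /q mulVKf.
  apply: filterS => t ht; apply: le_lt_trans (_ : e / 2 < e).
    exact: mx_norm_le (ltW e2) ht.
  lra.
have /choice[xi xiP] : forall t, exists xi : 'I_n -> 'rV[R]_n, `|h t| < r ->
    (forall k, `|xi k - phi x| <= `|h t|) /\
    f (phi x + h t) - f (phi x) = \sum_k h t 0 k * pderiv k f (xi k).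
  move=> t; have [hr|] := boolP (`|h t| < r).
    by have [xi ?] := mean_value_box hr df; exists xi.
  (* A default value: the required property is vacuous when the increment is not below [r]. *)
  by exists (fun=> 0).
have xi_cvg k : (fun t => xi t k) @ 0^' --> phi x.
  apply/cvgrPdist_lt => e e0; near=> t.
  have hr : `|h t| < r by near: t; exact: h_small.
  rewrite distrC; have [/(_ k) xk _] := xiP t hr; apply: le_lt_trans xk _.
  by near: t; exact: h_small.
have Q : (fun t => t^-1 *: (((f \o phi) \o shift x) (t *: v) - (f \o phi) x)) @ 0^' -->
    \sum_k 'D_v (fun z => phi z 0 k) x * pderiv k f (phi x).
  have : (fun t => \sum_k q k t * pderiv k f (xi t k)) @ 0^' -->
      \sum_k 'D_v (fun z => phi z 0 k) x * pderiv k f (phi x).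
    apply: cvg_big => [|k _]; first exact: add_continuous.
    apply: cvgM (q_cvg k) _.
    exact: cvg_comp (xi_cvg k) (cf k).
  apply: cvg_trans; apply: near_eq_cvg; near=> t.
  have hr : `|h t| < r by near: t; exact: h_small.
  have [_ E] := xiP t hr; rewrite /= -[phi (t *: v + x)](subrK (phi x)) addrC -/(h t) addrC.
  rewrite [h t + _]addrC E scaler_sumr; apply: eq_bigr => k _.
  by rewrite /q -mulrA.
by apply: DeriveDef; [apply/cvg_ex; eexists; exact: Q | exact: cvg_lim Q].
Unshelve. all: by end_near. Qed.

End ChainRule.

(** * Closure properties of smooth functions *)

Section SmoothClosure.
Context {R : realType} {n : nat}.
Implicit Types (U : set 'rV[R]_n) (f g : 'rV[R]_n -> R) (x : 'rV[R]_n) (i : 'I_n).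

Lemma near_eq_open U f g x : open U -> (forall y, U y -> f y = g y) -> U x ->
  \forall y \near x, f y = g y.
Proof.
by move=> Uo fg Ux; apply: filterS (open_nbhs_nbhs (conj Uo Ux)).
Qed.

Lemma pderiv_eq_on U f g x i : open U -> (forall y, U y -> f y = g y) -> U x ->
  pderiv i f x = pderiv i g x.
Proof. by move=> Uo fg Ux; apply/near_eq_derive/(near_eq_open Uo fg Ux). Qed.

Lemma pderiv_add f g x i :
  derivable f x (delta_mx 0 i) -> derivable g x (delta_mx 0 i) ->
  pderiv i (fun y => f y + g y) x = pderiv i f x + pderiv i g x.
Proof. exact: deriveD. Qed.

Lemma pderiv_mul f g x i :
  derivable f x (delta_mx 0 i) -> derivable g x (delta_mx 0 i) ->
  pderiv i (fun y => f y * g y) x = pderiv i f x * g x + f x * pderiv i g x.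
Proof.
by move=> df dg; rewrite /pderiv (deriveM df dg) addrC; congr (_ + _); exact: mulrC.
Qed.

Lemma Ck_continuous k U f x : Ck k U f -> U x -> {for x, continuous f}.
Proof. by case: k => [|k] [+ _]; exact. Qed.

Lemma Ck_derivable k U f x i : Ck k.+1 U f -> U x -> derivable f x (delta_mx 0 i).
Proof. by move=> [_ /(_ i)[+ _]]; exact. Qed.

Lemma Ck_pderiv k U f i : Ck k.+1 U f -> Ck k U (pderiv i f).
Proof. by move=> [_ /(_ i)[_]]. Qed.

Lemma Ck_pred k U f : Ck k.+1 U f -> Ck k U f.
Proof.
elim: k f => [|k IH] f [cf df]; split=> // i.
by have [di /IH] := df i.
Qed.

Lemma continuous_eq_on U f g x : open U -> (forall y, U y -> f y = g y) -> U x ->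
  {for x, continuous f} -> {for x, continuous g}.
Proof.
move=> Uo fg Ux cf; change (g @ x --> g x); rewrite -(fg _ Ux).
exact: cvg_trans (near_eq_cvg (near_eq_open Uo fg Ux)) cf.
Qed.

Lemma Ck_eq_on k U f g : open U -> (forall y, U y -> f y = g y) ->
  Ck k U f -> Ck k U g.
Proof.
move=> Uo; elim: k f g => [|k IH] f g fg [cf df]; split=> //.
- by move=> x Ux; exact: continuous_eq_on Uo fg Ux (cf x Ux).
- by move=> x Ux; exact: continuous_eq_on Uo fg Ux (cf x Ux).
- move=> i; have [dfi cki] := df i; split=> [x Ux|].
    apply: near_eq_derivable (dfi x Ux); exact: near_eq_open Uo fg Ux.
  apply: IH cki => x Ux; exact: pderiv_eq_on Uo fg Ux.
Qed.

Lemma Ck_subset k U W f : W `<=` U -> Ck k U f -> Ck k W f.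
Proof.
move=> WU; elim: k f => [|k IH] f [cf df]; split=> //; try by move=> x /WU /cf.
by move=> i; have [dfi /IH] := df i; split=> // x /WU /dfi.
Qed.

Lemma Ck_cst k U (a : R) : open U -> Ck k U (fun=> a).
Proof.
move=> Uo; elim: k a => [|k IH] a; split=> //; try by move=> x _; exact: cst_continuous.
move=> i; split=> [x _|]; first exact: derivable_cst.
by apply: (Ck_eq_on Uo _ (IH 0)) => x _; rewrite /pderiv derive_cst.
Qed.

Lemma CkD k U f g : open U -> Ck k U f -> Ck k U g ->
  Ck k U (fun x => f x + g x).
Proof.
move=> Uo; elim: k f g => [|k IH] f g Hf Hg; split=> //;
  try by move=> x Ux;
    exact: continuousD (Ck_continuous Hf Ux) (Ck_continuous Hg Ux).
move=> i; split=> [x Ux|].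
  by apply: derivableD; [exact: Ck_derivable Hf Ux|exact: Ck_derivable Hg Ux].
apply: (Ck_eq_on Uo _ (IH _ _ (Ck_pderiv i Hf) (Ck_pderiv i Hg))) => x Ux.
by rewrite pderiv_add //; [exact: Ck_derivable Hf Ux|exact: Ck_derivable Hg Ux].
Qed.

Lemma CkM k U f g : open U -> Ck k U f -> Ck k U g ->
  Ck k U (fun x => f x * g x).
Proof.
move=> Uo; elim: k f g => [|k IH] f g Hf Hg; split=> //;
  try by move=> x Ux;
    exact: continuousM (Ck_continuous Hf Ux) (Ck_continuous Hg Ux).
move=> i; split=> [x Ux|].
  by apply: derivableM; [exact: Ck_derivable Hf Ux|exact: Ck_derivable Hg Ux].
apply: (Ck_eq_on Uo _ (CkD Uo (IH _ _ (Ck_pderiv i Hf) (Ck_pred Hg))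
  (IH _ _ (Ck_pred Hf) (Ck_pderiv i Hg)))) => x Ux.
by rewrite pderiv_mul //; [exact: Ck_derivable Hf Ux|exact: Ck_derivable Hg Ux].
Qed.

Lemma CkN k U f : open U -> Ck k U f -> Ck k U (fun x => - f x).
Proof.
move=> Uo Hf; apply: (Ck_eq_on Uo _ (CkM Uo (Ck_cst k (-1) Uo) Hf)) => x _.
by rewrite mulN1r.
Qed.

Lemma Ck_sum k U (I : Type) (r : seq I) (P : pred I) (F : I -> 'rV[R]_n -> R) :
  open U -> (forall j, Ck k U (F j)) ->
  Ck k U (fun x => \sum_(j <- r | P j) F j x).
Proof.
move=> Uo HF; elim: r => [|j r IH].
  by apply: (Ck_eq_on Uo _ (Ck_cst k 0 Uo)) => x _; rewrite big_nil.
have [Pj|Pj] := boolP (P j).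
  by apply: (Ck_eq_on Uo _ (CkD Uo (HF j) IH)) => x _; rewrite big_cons Pj.
by apply: (Ck_eq_on Uo _ IH) => x _; rewrite big_cons (negPf Pj).
Qed.

Lemma Ck_prod k U (I : Type) (r : seq I) (P : pred I) (F : I -> 'rV[R]_n -> R) :
  open U -> (forall j, Ck k U (F j)) ->
  Ck k U (fun x => \prod_(j <- r | P j) F j x).
Proof.
move=> Uo HF; elim: r => [|j r IH].
  by apply: (Ck_eq_on Uo _ (Ck_cst k 1 Uo)) => x _; rewrite big_nil.
have [Pj|Pj] := boolP (P j).
  by apply: (Ck_eq_on Uo _ (CkM Uo (HF j) IH)) => x _; rewrite big_cons Pj.
by apply: (Ck_eq_on Uo _ IH) => x _; rewrite big_cons (negPf Pj).
Qed.

(** The derivative -(1/f)(1/f) f' contains the reciprocal itself only at the order covered by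
    induction. *)
Lemma CkV k U f : open U -> (forall x, U x -> f x != 0) -> Ck k U f ->
  Ck k U (fun x => (f x)^-1).
Proof.
move=> Uo f0; elim: k => [|k IH] Hf; split=> //;
  try by move=> x Ux;
    exact: continuousV (f0 _ Ux) (Ck_continuous Hf Ux).
move=> i; split=> [x Ux|].
  by apply: derivableV; [exact: f0|exact: Ck_derivable Hf Ux].
have HV := IH (Ck_pred Hf).
apply: (Ck_eq_on Uo _ (CkM Uo (Ck_cst k (-1) Uo)
  (CkM Uo (CkM Uo HV HV) (Ck_pderiv i Hf)))) => x Ux.
rewrite /pderiv deriveV; [|exact: f0|exact: Ck_derivable Hf Ux].
by rewrite [RHS]mulNr mulN1r -invfM -expr2.
Qed.

End SmoothClosure.

Lemma continuous_row {R : realType} {n : nat} (T : topologicalType)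
    (phi : T -> 'rV[R]_n) (x : T) :
  (forall j, {for x, continuous (fun z => phi z 0 j)}) -> {for x, continuous phi}.
Proof.
move=> cphi; apply/cvgrPdist_lt => e e0.
have e2 : 0 < e / 2 by rewrite divr_gt0.
have : \forall y \near x, forall j, `|phi x 0 j - phi y 0 j| <= e / 2.
  by apply: filter_forall => j; have /cvgrPdist_le := cphi j; exact.
apply: filterS => y xy; apply: (@le_lt_trans _ _ (e / 2)); last by lra.
by apply: mx_norm_le (ltW e2) _ => j; rewrite !mxE.
Qed.

Section SmoothComposition.
Context {R : realType} {m n : nat}.

Lemma Ck_comp (W : set 'rV[R]_m) (U : set 'rV[R]_n)
    (phi : 'rV[R]_m -> 'rV[R]_n) (f : 'rV[R]_n -> R) k :
  open U -> open W -> (forall x, W x -> U (phi x)) ->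
  (forall j, Cinfty W (fun x => phi x 0 j)) -> Cinfty U f ->
  Ck k W (f \o phi) /\
  forall x i, W x -> pderiv i (f \o phi) x
    = \sum_j pderiv i (fun y => phi y 0 j) x * pderiv j f (phi x).
Proof.
move=> Uo Wo WU Hphi Hf.
(* Stated for every smooth [f'], because the induction on [k] passes from [f] to its partial
   derivatives. *)
have isd (f' : 'rV[R]_n -> R) x i : Cinfty U f' -> W x ->
    is_derive x (delta_mx 0 i) (f' \o phi)
    (\sum_j pderiv i (fun y => phi y 0 j) x * pderiv j f' (phi x)).
  move=> Hf' Wx.
  have /nbhs_ballP[r /= r0 rU] : nbhs (phi x) U.
    by apply: open_nbhs_nbhs; split=> //; exact: WU.
  apply: (is_derive_comp r0) => [j|y yr j|j].
  - exact: Ck_derivable (Hphi j 1) Wx.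
  - suff Uy : U y by exact: Ck_derivable (Hf' 1) Uy.
    by apply: rU; rewrite mx_norm_ball /ball_ /= distrC.
  - exact: Ck_continuous (Ck_pderiv j (Hf' 1)) (WU _ Wx).
have pd (f' : 'rV[R]_n -> R) x i : Cinfty U f' -> W x -> pderiv i (f' \o phi) x
    = \sum_j pderiv i (fun y => phi y 0 j) x * pderiv j f' (phi x).
  by move=> Hf' Wx; have [_] := isd f' x i Hf' Wx.
split; last by move=> x i; exact: pd.
have cphi x : W x -> {for x, continuous phi}.
  by move=> Wx; apply: continuous_row => j; exact: Ck_continuous (Hphi j 0) Wx.
have cont (f' : 'rV[R]_n -> R) x : Cinfty U f' -> W x -> {for x, continuous (f' \o phi)}.
  move=> Hf' Wx; apply: continuous_comp; first exact: cphi.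
  exact: Ck_continuous (Hf' 0) (WU _ Wx).
elim: k f Hf => [|k IH] f Hf; split=> //; try by move=> x; exact: cont.
move=> i; split=> [x Wx|]; first by have [] := isd f x i Hf Wx.
apply: (Ck_eq_on Wo _ (Ck_sum (index_enum _) xpredT Wo
  (fun j => CkM Wo (Ck_pderiv i (Hphi j k.+1)) (IH _ (fun k' => Ck_pderiv j (Hf k'.+1)))))).
by move=> x Wx; rewrite pd.
Qed.

End SmoothComposition.

(** * The ring of smooth functions on an open set *)

Record domain (R : realType) (n : nat) := Domain {
  dom :> set 'rV[R]_n;
  dom_open : open dom
}.

(* The value outside the domain is pinned to [0], so that smooth functions on
   the domain are determined by their values on it. *)
Record sfun (R : realType) (n : nat) (U : domain R n) := SFun {
  sfun_fun :> 'rV[R]_n -> R;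
  sfun_smooth : Cinfty U sfun_fun;
  sfun_out : forall x, ~ dom U x -> sfun_fun x = 0
}.

Section SmoothRing.
Context {R : realType} {n : nat} {U : domain R n}.
Implicit Types (f g : sfun U) (x : 'rV[R]_n).

Let Uo : open U := @dom_open _ _ U.

Lemma sfunP f g : (forall x, dom U x -> f x = g x) -> f = g.
Proof.
move=> fg; have {}fg : sfun_fun f = sfun_fun g.
  apply/funext => x; have [/fg//|nUx] := pselect (dom U x).
  by rewrite !sfun_out.
case: f g fg => [f f1 f2] [g g1 g2] /= fg; case: _ / fg in g1 g2 *.
by congr SFun; exact: Prop_irrelevance.
Qed.

Definition extend0 (F : 'rV[R]_n -> R) x : R := if `[< dom U x >] then F x else 0.

Lemma extend0E F x : dom U x -> extend0 F x = F x.
Proof. by rewrite /extend0 => Ux; rewrite asboolT. Qed.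

Lemma extend0_out F x : ~ dom U x -> extend0 F x = 0.
Proof. by rewrite /extend0 => Ux; rewrite asboolF. Qed.

Lemma extend0_smooth F : Cinfty U F -> Cinfty U (extend0 F).
Proof. by move=> HF k; apply: Ck_eq_on (HF k) => // x Ux; rewrite extend0E. Qed.

(* Opaque, so that unification does not compare functions by unfolding the ring
   operations. *)
Fact mksfun_key F (HF : Cinfty U F) : {f : sfun U | forall x, dom U x -> f x = F x}.
Proof.
by exists (SFun (extend0_smooth HF) (@extend0_out F)) => x; exact: extend0E.
Qed.

Definition mksfun F (HF : Cinfty U F) : sfun U := sval (mksfun_key HF).

Lemma mksfunE F (HF : Cinfty U F) x : dom U x -> mksfun HF x = F x.
Proof. exact: svalP (mksfun_key HF) x. Qed.

Definition scst (a : R) : sfun U := mksfun (fun k => Ck_cst k a Uo).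
Definition sadd f g : sfun U :=
  mksfun (fun k => CkD Uo (sfun_smooth f k) (sfun_smooth g k)).
Definition smul f g : sfun U :=
  mksfun (fun k => CkM Uo (sfun_smooth f k) (sfun_smooth g k)).
Definition sopp f : sfun U := mksfun (fun k => CkN Uo (sfun_smooth f k)).

Lemma scstE a x : dom U x -> scst a x = a. Proof. exact: mksfunE. Qed.
Lemma saddE f g x : dom U x -> sadd f g x = f x + g x. Proof. exact: mksfunE. Qed.
Lemma smulE f g x : dom U x -> smul f g x = f x * g x. Proof. exact: mksfunE. Qed.
Lemma soppE f x : dom U x -> sopp f x = - f x. Proof. exact: mksfunE. Qed.

HB.instance Definition _ := gen_eqMixin (sfun U).
HB.instance Definition _ := gen_choiceMixin (sfun U).

Let saddA : associative sadd.
Proof. by move=> f g h; apply: sfunP => x Ux; rewrite !saddE// addrA. Qed.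
Let saddC : commutative sadd.
Proof. by move=> f g; apply: sfunP => x Ux; rewrite !saddE// addrC. Qed.
Let sadd0 : left_id (scst 0) sadd.
Proof. by move=> f; apply: sfunP => x Ux; rewrite saddE// scstE// add0r. Qed.
Let saddN : left_inverse (scst 0) sopp sadd.
Proof. by move=> f; apply: sfunP => x Ux; rewrite saddE// soppE// scstE// addNr. Qed.

HB.instance Definition _ := GRing.isZmodule.Build (sfun U) saddA saddC sadd0 saddN.

Let smulA : associative smul.
Proof. by move=> f g h; apply: sfunP => x Ux; rewrite !smulE// mulrA. Qed.
Let smulC : commutative smul.
Proof. by move=> f g; apply: sfunP => x Ux; rewrite !smulE// mulrC. Qed.
Let smul1 : left_id (scst 1) smul.
Proof. by move=> f; apply: sfunP => x Ux; rewrite smulE// scstE// mul1r. Qed.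
Let smulDl : left_distributive smul sadd.
Proof. by move=> f g h; apply: sfunP => x Ux; rewrite !(saddE, smulE)// mulrDl. Qed.

HB.instance Definition _ :=
  GRing.Zmodule_isComPzRing.Build (sfun U) smulA smulC smul1 smulDl.

Lemma sfunDE f g x : dom U x -> (f + g) x = f x + g x. Proof. exact: saddE. Qed.
Lemma sfunME f g x : dom U x -> (f * g) x = f x * g x. Proof. exact: smulE. Qed.
Lemma sfunNE f x : dom U x -> (- f) x = - f x. Proof. exact: soppE. Qed.
Lemma sfun0E x : dom U x -> (0 : sfun U) x = 0. Proof. exact: scstE. Qed.
Lemma sfun1E x : dom U x -> (1 : sfun U) x = 1. Proof. exact: scstE. Qed.
Lemma sfun_sumE (I : Type) (r : seq I) (P : pred I) (F : I -> sfun U) x : dom U x ->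
  (\sum_(j <- r | P j) F j) x = \sum_(j <- r | P j) F j x.
Proof.
move=> Ux; apply: (big_morph (fun f : sfun U => f x)); last exact: sfun0E.
by move=> f g; exact: sfunDE.
Qed.

Lemma sfun_pderiv_smooth i f : Cinfty U (pderiv i f).
Proof. by move=> k; exact: Ck_pderiv (sfun_smooth f k.+1). Qed.

Definition sder i f : sfun U := mksfun (sfun_pderiv_smooth i f).

Lemma sderE i f x : dom U x -> sder i f x = pderiv i f x. Proof. exact: mksfunE. Qed.

Lemma sfun_derivable f x i : dom U x -> derivable f x (delta_mx 0 i).
Proof. exact: Ck_derivable (sfun_smooth f 1). Qed.

Let sderD i : {morph sder i : f g / f + g}.
Proof.
move=> f g; apply: sfunP => x Ux; rewrite sderE// sfunDE// !sderE//.
rewrite -pderiv_add; [|exact: sfun_derivable|exact: sfun_derivable].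
by apply: (pderiv_eq_on i Uo) Ux => y Uy; exact: sfunDE.
Qed.

Let sderM i f g : sder i (f * g) = sder i f * g + f * sder i g.
Proof.
apply: sfunP => x Ux; rewrite sderE// sfunDE// !sfunME// !sderE//.
rewrite -pderiv_mul; [|exact: sfun_derivable|exact: sfun_derivable].
by apply: (pderiv_eq_on i Uo) Ux => y Uy; exact: sfunME.
Qed.

Let sderC i j f : sder i (sder j f) = sder j (sder i f).
Proof.
apply: sfunP => x Ux.
apply: etrans (sderE i (sder j f) Ux) _.
apply: etrans _ (esym (sderE j (sder i f) Ux)).
transitivity (pderiv i (pderiv j f) x).
  by apply: (pderiv_eq_on i Uo) Ux => y Uy; exact: sderE.
transitivity (pderiv j (pderiv i f) x); last first.
  by apply: (pderiv_eq_on j Uo) Ux => y Uy; exact: esym (sderE i f Uy).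
have /nbhs_ballP[r /= r0 rU] : nbhs x U by exact: open_nbhs_nbhs.
have {}rU y : `|y - x| < r -> dom U y.
  by move=> yr; apply: rU; rewrite mx_norm_ball /ball_ /= distrC.
apply: (pderivC _ _ r0) => [y /rU Uy k|y /rU Uy l k|k l].
- exact: sfun_derivable.
- exact: Ck_derivable (sfun_pderiv_smooth l f 1) Uy.
- exact: Ck_continuous (Ck_pderiv k (sfun_pderiv_smooth l f 1)) Ux.
Qed.

Definition sfun_derivations : commuting_derivations (sfun U) n :=
  CommutingDerivations sderD sderM sderC.

Lemma sfun_derE i f x : dom U x -> sfun_derivations i f x = pderiv i f x.
Proof. exact: sderE. Qed.

End SmoothRing.

Arguments sfun_derivations {R n} U.

(** * Pullback along a smooth map as a ring morphism *)

Section Pullback.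
Context {R : realType} {m n : nat} (W : domain R m) (U : domain R n).
Context (phi : 'rV[R]_m -> 'rV[R]_n).
Hypothesis phi_smooth : forall j, Cinfty W (fun x => phi x 0 j).
Hypothesis phi_dom : forall x, dom W x -> dom U (phi x).

Let comp_smooth (f : sfun U) : Cinfty W (f \o phi).
Proof.
by move=> k; have [] := Ck_comp k (@dom_open _ _ U) (@dom_open _ _ W) phi_dom
  phi_smooth (sfun_smooth f).
Qed.

Definition pullback (f : sfun U) : sfun W := mksfun (comp_smooth f).

Lemma pullbackE f x : dom W x -> pullback f x = f (phi x). Proof. exact: mksfunE. Qed.

Let pullback_zmod : zmod_morphism pullback.
Proof.
move=> f g; apply: sfunP => x Wx; have Ux := phi_dom Wx.
by rewrite !(sfunDE, sfunNE, pullbackE).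
Qed.

Let pullback_monoid : monoid_morphism pullback.
Proof.
split=> [|f g]; apply: sfunP => x Wx; have Ux := phi_dom Wx.
  by rewrite pullbackE// !sfun1E.
by rewrite !(sfunME, pullbackE).
Qed.

HB.instance Definition _ :=
  GRing.isZmodMorphism.Build (sfun U) (sfun W) pullback pullback_zmod.
HB.instance Definition _ :=
  GRing.isMonoidMorphism.Build (sfun U) (sfun W) pullback pullback_monoid.

Lemma der_pullback i (f : sfun U) : sfun_derivations W i (pullback f) =
  \sum_k sfun_derivations W i (mksfun (phi_smooth k))
         * pullback (sfun_derivations U k f).
Proof.
apply: sfunP => x Wx; have Ux := phi_dom Wx.
rewrite sfun_sumE// sfun_derE//.
have [_ chain] := Ck_comp 0 (@dom_open _ _ U) (@dom_open _ _ W) phi_dom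
  phi_smooth (sfun_smooth f).
transitivity (pderiv i (f \o phi) x).
  by apply: (pderiv_eq_on i (@dom_open _ _ W)) Wx => y Wy; exact: pullbackE.
rewrite chain//; apply: eq_bigr => k _.
rewrite sfunME// pullbackE// !sfun_derE//; congr (_ * _); apply/esym.
by apply: (pderiv_eq_on i (@dom_open _ _ W)) Wx => y Wy; exact: mksfunE.
Qed.

End Pullback.

(** * Curvature in a chart *)

Section SmoothMatrices.
Context {R : realType} {n : nat} {U : domain R n}.

Let Uo : open U := @dom_open _ _ U.

Lemma smooth_det m (A : 'rV[R]_n -> 'M[R]_m) :
  (forall i j, Cinfty U (fun x => A x i j)) -> Cinfty U (fun x => \det (A x)).
Proof.
move=> HA k; rewrite /determinant; apply: Ck_sum Uo _ => s.
by apply: CkM Uo (Ck_cst _ _ Uo) _; apply: Ck_prod Uo _ => i; exact: HA.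
Qed.

(** Cramer's rule: an entry of the inverse is a cofactor, polynomial in the entries, over the
    determinant. *)
Lemma smooth_invmx m (A : 'rV[R]_n -> 'M[R]_m) i j :
  (forall x, dom U x -> A x \in unitmx) ->
  (forall i j, Cinfty U (fun x => A x i j)) ->
  Cinfty U (fun x => invmx (A x) i j).
Proof.
move=> Au HA k.
have det0 x : dom U x -> \det (A x) != 0.
  by move=> /Au; rewrite unitmxE unitfE.
have cof : Ck k U (fun x => cofactor (A x) j i).
  apply: CkM Uo (Ck_cst _ _ Uo) _.
  by apply: smooth_det => i' j' k'; apply: Ck_eq_on Uo _ (HA _ _ k') => x _; rewrite !mxE.
apply: Ck_eq_on Uo _ (CkM Uo (CkV Uo det0 (smooth_det HA k)) cof) => x Ux.
by rewrite /invmx Au// !mxE.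
Qed.

Lemma sfun_der_eval i (f : sfun U) F x : dom U x -> (forall y, dom U y -> f y = F y) ->
  sfun_derivations U i f x = pderiv i F x.
Proof. by move=> Ux fF; rewrite sfun_derE//; exact: (pderiv_eq_on i Uo). Qed.

End SmoothMatrices.

Section ChartGeometry.
Context {R : realType} {n : nat} {M : smoothManifold R n} (g : riemannianMetric M).
(** [U] is kept general so that it can be the whole range of the chart, for pointwise identities, or
    the overlap with another chart, for the change of coordinates. *)
Context (c : mchart M) (U : domain R n) (Uc : dom U `<=` crange c).
Implicit Types (x : 'rV[R]_n) (i j k l m : 'I_n).

Lemma metric_unit x : crange c x -> g c x \in unitmx.
Proof.
move=> cx; rewrite -row_free_unit -kermx_eq0; apply/rowV0P => v /sub_kermxP vg0.
apply/eqP; apply: contraT => /(@g_posdef _ _ _ g _ _ cx).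
by rewrite vg0 mul0mx mxE ltxx.
Qed.

Let g_smoothU i j : Cinfty U (fun x => g c x i j).
Proof. by move=> k; apply: Ck_subset Uc (g_smooth g c i j k). Qed.

Let ginv_smoothU i j : Cinfty U (fun x => ginv g c x i j).
Proof.
by move=> k; apply: smooth_invmx => // x /Uc; exact: metric_unit.
Qed.

Definition chart_metric : 'M[sfun U]_n := \matrix_(i, j) mksfun (g_smoothU i j).
Definition chart_ginv : 'M[sfun U]_n := \matrix_(i, j) mksfun (ginv_smoothU i j).
Definition shalf : sfun U := scst 2^-1.

Local Notation d := (sfun_derivations U).
Local Notation gg := chart_metric.
Local Notation hh := chart_ginv.
Local Notation G := (levi_civita d gg hh shalf).

Lemma chart_metricE i j x : dom U x -> gg i j x = g c x i j.
Proof. by move=> Ux; rewrite mxE mksfunE. Qed.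

Lemma chart_ginvE i j x : dom U x -> hh i j x = ginv g c x i j.
Proof. by move=> Ux; rewrite mxE mksfunE. Qed.

Lemma chart_metric_sym : gg^T = gg.
Proof.
apply/matrixP => i j; rewrite [LHS]mxE; apply: sfunP => x Ux; rewrite !chart_metricE//.
by rewrite -[in RHS](g_sym g (Uc Ux)) mxE.
Qed.

Lemma chart_metric_ginv : gg *m hh = 1%:M.
Proof.
apply/matrixP => i j; apply: sfunP => x Ux; rewrite mxE sfun_sumE//.
transitivity ((g c x *m invmx (g c x)) i j).
  rewrite mxE; apply: eq_bigr => k _.
  by rewrite sfunME// chart_metricE// chart_ginvE.
rewrite mulmxV; last exact: metric_unit (Uc Ux).
rewrite !mxE; case: eqP => _; first exact: esym (sfun1E Ux).
exact: esym (sfun0E Ux).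
Qed.

Lemma shalfK : shalf + shalf = 1.
Proof.
apply: sfunP => x Ux; rewrite sfunDE// sfun1E// !scstE//.
by rewrite [RHS](splitr 1) mul1r.
Qed.

Lemma chart_christoffelE l i j x : dom U x -> G l i j x = christoffel g c l i j x.
Proof.
move=> Ux; rewrite /levi_civita /christoffel sfunME// scstE// sfun_sumE//.
congr (_ * _); apply: eq_bigr => k _.
rewrite sfunME// chart_ginvE// !sfunDE// sfunNE//.
by congr (_ * (_ + _ - _)); apply: sfun_der_eval => // y Uy; exact: chart_metricE.
Qed.

Local Opaque levi_civita.

Lemma chart_curvE l k i j x : dom U x -> curv d G l k i j x = riemann g c l k i j x.
Proof.
move=> Ux; rewrite /curv /riemann !sfunDE// sfunNE// sfun_sumE//.
congr (_ - _ + _).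
- by apply: sfun_der_eval => // y Uy; exact: chart_christoffelE.
- by apply: sfun_der_eval => // y Uy; exact: chart_christoffelE.
apply: eq_bigr => m _; rewrite sfunDE// sfunNE//.
congr (_ - _).
  apply: etrans (sfunME _ _ Ux) _.
  by congr (_ * _); exact: chart_christoffelE.
apply: etrans (sfunME _ _ Ux) _.
by congr (_ * _); exact: chart_christoffelE.
Qed.

Lemma chart_ricE i j x : dom U x -> ric d G i j x = ricci g c i j x.
Proof.
move=> Ux; rewrite /ric /ricci sfun_sumE//.
by apply: eq_bigr => l _; exact: chart_curvE.
Qed.

Lemma chart_scalE x : dom U x -> scalar_curv d gg hh shalf x = scal g c x.
Proof.
move=> Ux; rewrite /scalar_curv /scal sfun_sumE//; apply: eq_bigr => i _.
rewrite sfun_sumE//; apply: eq_bigr => j _.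
by rewrite sfunME// chart_ginvE// chart_ricE.
Qed.

Lemma chart_covE (T : 'I_n -> 'I_n -> sfun U) F i j l x : dom U x ->
  (forall i j y, dom U y -> T i j y = F i j y) ->
  cov d G T i j l x = covderiv2 g c F i j l x.
Proof.
move=> Ux TF; rewrite /cov /covderiv2 sfunDE// sfunNE// sfun_sumE//.
congr (_ - _); first exact: sfun_der_eval (TF i j).
apply: eq_bigr => m _; rewrite sfunDE//; congr (_ + _).
  apply: etrans (sfunME _ _ Ux) _.
  by congr (_ * _); [exact: chart_christoffelE | exact: TF].
apply: etrans (sfunME _ _ Ux) _.
by congr (_ * _); [exact: chart_christoffelE | exact: TF].
Qed.

End ChartGeometry.

(** * Ricci symmetry, traces and the contracted Bianchi identity in a chart *)

Section ChartIdentities.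
Context {R : realType} {n : nat} {M : smoothManifold R n} (g : riemannianMetric M).
Context (c : mchart M).
Implicit Types (x : 'rV[R]_n) (i j k l m : 'I_n).

Let U : domain R n := Domain (@crange_open _ _ M c).
Let Uc : dom U `<=` crange c. Proof. by []. Qed.

Local Notation d := (sfun_derivations U).
Local Notation gg := (chart_metric g Uc).
Local Notation hh := (chart_ginv g Uc).
Local Notation half := (@shalf R n U).
Local Notation G := (levi_civita d gg hh half).

Let ggT : gg^T = gg. Proof. exact: chart_metric_sym. Qed.
Let gh1 : gg *m hh = 1%:M. Proof. exact: chart_metric_ginv. Qed.
Let halfK : half + half = 1. Proof. exact: shalfK. Qed.

Let der_scal l x : dom U x ->
  d l (scalar_curv d gg hh half) x = pderiv l (scal g c) x.
Proof. by move=> Ux; apply: sfun_der_eval => // y Uy; exact: chart_scalE. Qed.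

Let cov_ric i j l x : dom U x ->
  cov d G (ric d G) i j l x = covderiv2 g c (ricci g c) i j l x.
Proof. by move=> Ux; apply: chart_covE => // i' j' y Uy; exact: chart_ricE. Qed.

Lemma ginv_sym i j x : crange c x -> ginv g c x i j = ginv g c x j i.
Proof.
move=> Ux; have hT := inv_sym ggT gh1.
by rewrite -(chart_ginvE g Uc i j Ux) -{1}hT mxE chart_ginvE.
Qed.

Lemma ricci_sym i j x : crange c x -> ricci g c i j x = ricci g c j i x.
Proof.
by move=> Ux; rewrite -!(chart_ricE g Uc _ _ Ux) (ric_sym _ ggT gh1 halfK).
Qed.

Lemma scal_smooth : Cinfty (crange c) (scal g c).
Proof.
move=> k; apply: (Ck_eq_on (@crange_open _ _ M c) _
  (sfun_smooth (scalar_curv d gg hh half) k)) => x Ux.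
exact: chart_scalE.
Qed.

Lemma pderiv_scal l x : crange c x -> pderiv l (scal g c) x =
  \sum_i \sum_j ginv g c x i j * covderiv2 g c (ricci g c) i j l x.
Proof.
move=> Ux; rewrite -(der_scal l Ux).
transitivity ((\sum_i \sum_j hh i j * cov d G (ric d G) i j l) x).
  congr (sfun_fun _ x).
  have := der_trace_inv d ggT gh1 halfK l (\matrix_(i, j) ric d G i j).
  rewrite /scalar_curv; under eq_bigr do under eq_bigr do rewrite mxE.
  move=> ->; apply: eq_bigr => i _; apply: eq_bigr => j _.
  by rewrite covmxE.
rewrite sfun_sumE//; apply: eq_bigr => i _; rewrite sfun_sumE//.
by apply: eq_bigr => j _; rewrite sfunME// chart_ginvE// cov_ric.
Qed.

Lemma pderiv_scal_divergence j x : crange c x -> pderiv j (scal g c) x =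
  (\sum_l \sum_i ginv g c x l i * covderiv2 g c (ricci g c) i j l x) *+ 2.
Proof.
move=> Ux; rewrite -(der_scal j Ux) (contracted_bianchi d ggT gh1 halfK).
rewrite !mulr2n sfunDE//; congr (_ + _); rewrite sfun_sumE//;
  apply: eq_bigr => l _; rewrite sfun_sumE//; apply: eq_bigr => i _;
  by rewrite sfunME// chart_ginvE// cov_ric.
Qed.

Lemma covderiv2_schouten i j l x : crange c x ->
  covderiv2 g c (schouten g c) i j l x = covderiv2 g c (ricci g c) i j l x
    - pderiv l (scal g c) x / (2 * n%:R - 2) * g c x i j.
Proof.
move=> Ux; pose e : sfun U := scst (2 * n%:R - 2)^-1.
transitivity (cov d G (fun i j => ric d G i j
    - scalar_curv d gg hh half * e * gg i j) i j l x).
  apply/esym; apply: chart_covE => // i' j' y Uy.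
  rewrite /schouten sfunDE// sfunNE// !sfunME// chart_ricE// chart_scalE//.
  by rewrite scstE// chart_metricE.
rewrite (cov_shifted ggT gh1 halfK) => [|m]; last first.
  apply: sfunP => y Uy; rewrite (sfun_der_eval m Uy (fun z => @scstE _ _ U _ z)).
  by rewrite /pderiv derive_cst sfun0E.
rewrite sfunDE// sfunNE// !sfunME// cov_ric// der_scal// scstE//.
by rewrite chart_metricE.
Qed.

End ChartIdentities.

(** * Coordinate invariance of the scalar curvature *)

Section ChartChange.
Context {R : realType} {n : nat} {M : smoothManifold R n} (g : riemannianMetric M).
Context (c c' : mchart M).

Lemma coverlap_subset : coverlap c c' `<=` crange c.
Proof. by move=> _ [p [cp _] <-]; exists p. Qed.

(** The overlap is the preimage of [cdom c'] under [cparam c], which is continuous on the open set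
    [crange c]. *)
Lemma coverlap_open : open (coverlap c c').
Proof.
have -> : coverlap c c' = crange c `&` (cparam c @^-1` cdom c').
  apply/seteqP; split=> [_ [p [cp c'p] <-]|_ [[p cp <-]]] /=.
    by split; [exists p | rewrite ccoordK].
  by rewrite ccoordK// => c'p; exists p.
rewrite openE => x [cx c'x]; apply: filterI.
  by apply: open_nbhs_nbhs; split=> //; exact: crange_open.
have := @cparam_continuous _ _ M c.
rewrite continuous_open_subspace; last exact: crange_open.
move=> /(_ x (mem_set cx)); apply.
by apply: open_nbhs_nbhs; split=> //; exact: cdom_open.
Qed.

Lemma transition_range x : coverlap c c' x -> crange c' (transition c c' x).
Proof. by move=> [p [cp c'p] <-]; exists p => //; rewrite /transition ccoordK. Qed.

(** [scalar_curv_change] is applied to the functions on the overlap and those on the range of [c'],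
    linked by pullback along the transition map. *)
Lemma scal_change x : coverlap c c' x -> scal g c x = scal g c' (transition c c' x).
Proof.
move=> Wx; pose W : domain R n := Domain coverlap_open.
pose U : domain R n := Domain (@crange_open _ _ M c').
have phi_smooth k : Cinfty W (fun y => transition c c' y 0 k) := transition_smooth c c' k.
have Wc : dom W `<=` crange c := coverlap_subset.
have Uc : dom U `<=` crange c' by [].
pose psi := pullback phi_smooth (transition_range : forall y, dom W y -> dom U _).
pose J : 'M[sfun W]_n := \matrix_(i, k) sfun_derivations W i (mksfun (phi_smooth k)).
have JE i k y : dom W y -> J i k y = jac c c' y i k.
  move=> Wy; rewrite mxE (sfun_der_eval i Wy (F := fun y => transition c c' y 0 k))//.
  by move=> z Wz; rewrite mksfunE.
rewrite -(chart_scalE g Wc Wx) -(chart_scalE g Uc (transition_range Wx)).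
rewrite -[RHS](pullbackE phi_smooth (transition_range : forall y, dom W y -> dom U _))//.
congr (sfun_fun _ x).
apply: (@scalar_curv_change _ _ _ _ _ psi J).
- by move=> i f; rewrite der_pullback; apply: eq_bigr => k _; rewrite mxE.
- by move=> i j k; rewrite !mxE derC.
- exact: chart_metric_sym.
- exact: chart_metric_ginv.
- exact: shalfK.
- exact: chart_metric_sym.
- exact: chart_metric_ginv.
- exact: shalfK.
apply/matrixP => i j; apply: sfunP => y Wy; have Uy := transition_range Wy.
rewrite chart_metricE// (g_change g Wy) exchange_big mxE sfun_sumE//.
apply: eq_bigr => l _; rewrite sfunME// [J^T l j]mxE JE// mxE sfun_sumE//.
rewrite big_distrl; apply: eq_bigr => k _ /=.
rewrite sfunME// JE// [map_mx _ _ k l]mxE pullbackE// chart_metricE//.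
by rewrite mulrAC.
Qed.

End ChartChange.

(** * Pseudo Ricci symmetry *)

Section PseudoRicciSymmetric.
Context {R : realType} {n : nat} {M : smoothManifold R n} (g : riemannianMetric M).
Context (alpha : oneForm M).
Hypothesis prs : forall c x, crange c x -> forall i j l,
  covderiv2 g c (ricci g c) i j l x =
  2 * alpha c x 0 l * ricci g c i j x + alpha c x 0 i * ricci g c l j x
  + alpha c x 0 j * ricci g c i l x.
Context (c : mchart M) (x : 'rV[R]_n).
Hypothesis cx : crange c x.
Implicit Types i j k l : 'I_n.

Local Notation h := (fun i j => ginv g c x i j).
Local Notation Ric := (fun i j => ricci g c i j x).
Local Notation s := (scal g c x).
Local Notation A := (fun i => alpha c x 0 i).

(** The one-form Ric(alpha, .), shown to vanish in [prs_kernel]. *)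
Let V l : R := \sum_i \sum_j h i j * (A i * Ric j l).

Let trace_first l : \sum_i \sum_j h i j * (A j * Ric i l) = V l.
Proof.
rewrite exchange_big; apply: eq_bigr => i _; apply: eq_bigr => j _ /=.
by rewrite ginv_sym.
Qed.

Let pderiv_scal_prs l : pderiv l (scal g c) x = 2 * A l * s + 2 * V l.
Proof.
rewrite pderiv_scal//.
transitivity (2 * A l * s + (V l + V l)); last by rewrite [2 * V l]mulr_natl.
rewrite -{2}trace_first /V /scal big_distrr -!big_split; apply: eq_bigr => i _ /=.
rewrite big_distrr -!big_split; apply: eq_bigr => j _ /=.
rewrite prs// (ricci_sym g l j cx).
move: (ricci g c) (ginv g c) (alpha c x) => ? ? ?; ring.
Qed.

Let pderiv_scal_prs' l : pderiv l (scal g c) x = (3 * V l + A l * s) *+ 2.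
Proof.
rewrite pderiv_scal_divergence//; congr (_ *+ 2).
transitivity (2 * V l + V l + A l * s); last by ring.
rewrite -[X in _ + X + _]trace_first /V /scal !big_distrr -!big_split.
apply: eq_bigr => i _ /=; rewrite !big_distrr -!big_split; apply: eq_bigr => j _ /=.
rewrite prs// (ricci_sym g j i cx).
move: (ricci g c) (ginv g c) (alpha c x) => ? ? ?; ring.
Qed.

(** The trace over [i], [j] gives d sc = 2 sc alpha + 2 V, while the divergence and the contracted
    Bianchi identity give d sc = 2 sc alpha + 6 V. *)
Lemma prs_kernel l : \sum_i \sum_j ginv g c x i j * (alpha c x 0 i * ricci g c j l x) = 0.
Proof.
rewrite -/(V l); have := pderiv_scal_prs l; rewrite pderiv_scal_prs' => e.
lra.
Qed.

Lemma prs_pderiv_scal l : pderiv l (scal g c) x = 2 * alpha c x 0 l * scal g c x.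
Proof. by rewrite pderiv_scal_prs /V prs_kernel mulr0 addr0. Qed.

(** Antisymmetrizing in [j], [k] cancels the term with alpha_i and leaves coefficient 1 on the other
    two; d sc = 2 sc alpha turns the Schouten denominator 2n-2 into n-1. *)
Lemma prs_cotton i j k : (2 <= n)%N -> cotton g c i j k x =
  alpha c x 0 k * (ricci g c i j x - scal g c x / (n%:R - 1) * g c x i j)
  - alpha c x 0 j * (ricci g c i k x - scal g c x / (n%:R - 1) * g c x i k).
Proof.
move=> n2; have n1 : n%:R - 1 != 0 :> R.
  by rewrite subr_eq0 -[1]/(1%:R) eqr_nat; apply/eqP => n1; rewrite n1 in n2.
have n22 : 2 * n%:R - 2 != 0 :> R.
  by rewrite -[X in _ - X]mulr1 -mulrBr mulf_neq0// pnatr_eq0.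
rewrite /cotton !covderiv2_schouten// !prs// !prs_pderiv_scal (ricci_sym g k j cx).
have -> : 2 * A k * s / (2 * n%:R - 2) = A k * (s / (n%:R - 1)) by field; rewrite n1.
have -> : 2 * A j * s / (2 * n%:R - 2) = A j * (s / (n%:R - 1)) by field; rewrite n1.
move: (ricci g c) (g c x) (alpha c x) => ? ? ?; ring.
Qed.

End PseudoRicciSymmetric.

(** * Metric contractions at a point *)

Section PointwiseMetric.
Context {R : realType} {n : nat} {M : smoothManifold R n} (g : riemannianMetric M).
Context (c : mchart M) (x : 'rV[R]_n).
Hypothesis cx : crange c x.

Lemma sum_ginv_g i l : \sum_j ginv g c x i j * g c x j l = (i == l)%:R.
Proof.
have := mulVmx (metric_unit g cx) => /matrixP /(_ i l).
by rewrite !mxE => <-; apply: eq_bigr => j _.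
Qed.

Lemma contract_metric (v : 'I_n -> R) l :
  \sum_i \sum_j ginv g c x i j * (v i * g c x j l) = v l.
Proof.
transitivity (\sum_i v i * (i == l)%:R).
  apply: eq_bigr => i _; rewrite -sum_ginv_g big_distrr; apply: eq_bigr => j _ /=.
  by rewrite mulrCA.
by rewrite (bigD1 l)//= eqxx mulr1 big1 ?addr0// => i /negPf->; rewrite mulr0.
Qed.

Lemma trace_metric : \sum_i \sum_j ginv g c x i j * g c x i j = n%:R.
Proof.
transitivity (\sum_(i < n) (1 : R)); last first.
  by rewrite sumr_const card_ord.
apply: eq_bigr => i _; transitivity ((i == i)%:R : R); last by rewrite eqxx.
rewrite -sum_ginv_g; apply: eq_bigr => j _; congr (_ * _).
by rewrite -[in RHS](g_sym g cx) mxE.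
Qed.

(** Raising the index of [w] gives a nonzero vector [y] whose squared length under [g] is
    [normsq]. *)
Lemma normsq_gt0 (w : oneForm M) : w c x != 0 -> 0 < normsq g w c x.
Proof.
move=> w0; have gu := metric_unit g cx.
pose y := w c x *m invmx (g c x).
have y0 : y != 0.
  by apply: contraNneq w0 => e; rewrite -[w c x](mulmxKV gu) -/y e mul0mx.
suff -> : normsq g w c x = (y *m g c x *m y^T) 0 0 by exact: g_posdef.
rewrite /y mulmxKV// trmx_mul mulmxA mxE.
apply: eq_bigr => j _; rewrite mxE big_distrl; apply: eq_bigr => i _ /=.
by rewrite !mxE mulrAC [w c x 0 i * _]mulrC.
Qed.

End PointwiseMetric.

Lemma prs_quasi_einstein_cotton (R : realType) (n : nat) (M : smoothManifold R n)
    (g : riemannianMetric M) (a b : M -> R) (w : oneForm M) : (2 <= n)%N ->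
  pseudo_ricci_symmetric g -> quasi_einstein_with g a b w -> nowhere_zero_fun a ->
  ricci_cotton g.
Proof.
move=> n2 [alpha alpha0 prs] [_ _ w0 qe] a0 c x cx i j k.
rewrite (prs_cotton prs)//.
have N0 := normsq_gt0 g cx (w0 _ _ cx).
set N := normsq g w c x in N0.
have Ric i' j' : ricci g c i' j' x = a (cparam c x) * g c x i' j'
    + b (cparam c x) * (w c x 0 i' * w c x 0 j' / N) by exact: qe.
move: (a (cparam c x)) (b (cparam c x)) (a0 (cparam c x)) Ric.
move=> {qe a0 a b} a b a0 Ric.
have Nn0 : N != 0 by rewrite gt_eqF.
have n1 : n%:R - 1 != 0 :> R.
  by rewrite subr_eq0 -[1]/(1%:R) eqr_nat; apply/eqP => n1; rewrite n1 in n2.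
(* [mu] is the inner product of alpha and [w]; substituting the quasi Einstein form into
   [prs_kernel] gives [ker], and [a0] then makes alpha the multiple [la] of [w]. *)
pose mu := \sum_i \sum_j ginv g c x i j * (alpha c x 0 i * w c x 0 j).
have ker l : a * alpha c x 0 l + b * mu / N * w c x 0 l = 0.
  rewrite -(prs_kernel prs cx l) -{1}(contract_metric g cx (fun i => alpha c x 0 i) l).
  rewrite /mu !big_distrr !big_distrl -big_split; apply: eq_bigr => i' _ /=.
  rewrite !big_distrr !big_distrl -big_split; apply: eq_bigr => j' _ /=.
  by rewrite Ric; field.
pose la := - (b * mu / N) / a.
have al l : alpha c x 0 l = la * w c x 0 l.
  have : a * alpha c x 0 l = - (b * mu / N) * w c x 0 l.
    by apply/eqP; rewrite mulNr -addr_eq0 ker.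
  by move=> e; apply: (mulfI a0); rewrite e /la; field; rewrite a0.
have muE : mu = la * N.
  rewrite /mu /N /normsq big_distrr; apply: eq_bigr => i' _.
  by rewrite big_distrr; apply: eq_bigr => j' _ /=; rewrite al; ring.
have [l l0] : exists l, alpha c x 0 l != 0.
  apply/existsP; apply: contraT; rewrite negb_exists => /forallP z.
  have /negP[] := alpha0 _ _ cx; apply/eqP/rowP => l; rewrite [RHS]mxE.
  by apply/eqP; rewrite -[_ == _]negbK z.
(* With mu = la N, [ker] becomes (a + b) alpha = 0, evaluated at a nonzero component of alpha. *)
have ab : a + b = 0.
  have := ker l; rewrite muE -[_ * w c x 0 l]mulrA => e.
  apply: (mulIf l0); rewrite mul0r mulrDl -[RHS]e; congr (_ + _).
  by rewrite [in LHS]al; field.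
have sE : scal g c x = (n%:R - 1) * a.
  have -> : (n%:R - 1) * a = a * n%:R + b * (N / N).
    by rewrite divff// -(addr0_eq ab); ring.
  rewrite -(trace_metric g cx) {1}/N /normsq big_distrl !big_distrr -big_split.
  apply: eq_bigr => i' _ /=; rewrite big_distrl !big_distrr -big_split.
  apply: eq_bigr => j' _ /=.
  by rewrite Ric; ring.
(* What remains of the bracket in [prs_cotton] is a multiple of w_i w_j; since alpha is a multiple
   of [w], its product with alpha_k is symmetric in [j], [k], so the difference vanishes. *)
have -> : scal g c x / (n%:R - 1) = a by rewrite sE; field.
by rewrite !Ric !al; ring.
Qed.

(** * From Cotton to quasi Einstein *)

Section CottonQuasiEinstein.
Context {R : realType} {n : nat} {M : smoothManifold R n} (g : riemannianMetric M).

Let chart_at (p : M) : mchart M := sval (cid (cdom_cover p)).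

Let chart_atP p : cdom (chart_at p) p.
Proof. exact: svalP (cid (cdom_cover p)). Qed.

(** The scalar curvature as a function on [M], through a chosen chart at each point; [scal_funE]
    removes the dependence on the choice. *)
Definition scal_fun (p : M) : R := scal g (chart_at p) (ccoord (chart_at p) p).

Lemma scal_funE c x : crange c x -> scal_fun (cparam c x) = scal g c x.
Proof.
move=> [p cp <-]; rewrite ccoordK// /scal_fun.
have Wx : coverlap c (chart_at p) (ccoord c p).
  by exists p => //; split=> //; exact: chart_atP.
by rewrite (scal_change g Wx) /transition ccoordK.
Qed.

Lemma scal_fun_smooth (t : R) : smooth_fun (fun p => t * scal_fun p).
Proof.
move=> c k; have Uo : open (crange c) := @crange_open _ _ M c.
apply: (Ck_eq_on Uo _ (CkM Uo (Ck_cst k t Uo) (@scal_smooth _ _ _ g c k))) => x cx.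
by rewrite /= scal_funE.
Qed.

Lemma prs_cotton_quasi_einstein : (2 <= n)%N ->
  pseudo_ricci_symmetric g -> ricci_cotton g -> quasi_einstein g.
Proof.
move=> n2 [alpha alpha0 prs] cot.
pose t : R := (n%:R - 1)^-1.
(* The witnesses are a = sc/(n-1), b = -a and w = alpha. *)
exists (fun p => t * scal_fun p), (fun p => - t * scal_fun p), alpha.
split=> // [||c x cx i j]; try exact: scal_fun_smooth.
rewrite scal_funE//; have N0 := normsq_gt0 g cx (alpha0 _ _ cx).
set N := normsq g alpha c x in N0 *.
have Nn0 : N != 0 by rewrite gt_eqF.
set K := t * scal g c x.
(* [u] is alpha with its index raised: it pairs with alpha to [N], is annihilated by Ricci, and
   lowers back to alpha. *)
pose u k := \sum_m ginv g c x m k * alpha c x 0 m.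
have Nu : \sum_k u k * alpha c x 0 k = N.
  rewrite /N /normsq exchange_big; apply: eq_bigr => k _ /=.
  by rewrite /u big_distrl.
have uRic : \sum_k u k * ricci g c k i x = 0.
  apply: etrans _ (prs_kernel prs cx i); rewrite [RHS]exchange_big.
  apply: eq_bigr => k _ /=.
  by rewrite /u big_distrl; apply: eq_bigr => m _ /=; rewrite mulrA.
have ug : \sum_k u k * g c x k i = alpha c x 0 i.
  rewrite -[RHS](contract_metric g cx (fun i => alpha c x 0 i)) [RHS]exchange_big.
  apply: eq_bigr => k _ /=.
  by rewrite /u big_distrl; apply: eq_bigr => m _ /=; rewrite mulrA.
have gC k : g c x i k = g c x k i by rewrite -{1}(g_sym g cx) mxE.
have : \sum_k u k * cotton g c i j k x = 0.
  by apply: big1 => k _; rewrite cot// mulr0.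
(* Contracting the formula of [prs_cotton] with [u] turns C = 0 into N (Ri_ij - K g_ij) + K alpha_i
   alpha_j = 0. *)
have -> : \sum_k u k * cotton g c i j k x =
    (\sum_k u k * alpha c x 0 k) * (ricci g c i j x - K * g c x i j)
    - alpha c x 0 j * (\sum_k u k * ricci g c k i x - K * \sum_k u k * g c x k i).
  rewrite [K * \sum_k _]big_distrr -sumrB big_distrl big_distrr -sumrB.
  apply: eq_bigr => k _ /=; rewrite (prs_cotton prs)// (gC k) (ricci_sym g i k cx).
  rewrite (_ : scal g c x / _ = K); last by rewrite mulrC.
  move: (alpha c x) (u k) (ricci g c k i x) (g c x k i) => ? ? ? ?; ring.
rewrite Nu uRic ug => e.
have {e} : N * (ricci g c i j x - K * g c x i j)
    = - (K * (alpha c x 0 i * alpha c x 0 j)).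
  by apply: subr0_eq; apply: etrans e; ring.
move=> e; apply: (mulfI Nn0); rewrite mulNr -/K.
have -> : N * ricci g c i j x = N * (ricci g c i j x - K * g c x i j) + N * (K * g c x i j).
  ring.
by rewrite e; field.
Qed.

End CottonQuasiEinstein.

Theorem lemma3p6 (R : realType) (n : nat) (hn : (3 <= n)%N)
    (M : smoothManifold R n) (g : riemannianMetric M)
    (hRi : ricci_nonzero g)
    (hprs : pseudo_ricci_symmetric g)
    (hsc : scal_nonzero g) :
  (forall (a b : M -> R) (w : oneForm M),
      quasi_einstein_with g a b w -> nowhere_zero_fun a -> ricci_cotton g)
  /\ (ricci_cotton g -> quasi_einstein g).
Proof.
have n2 : (2 <= n)%N := ltnW hn; split.
  by move=> a b w; exact: prs_quasi_einstein_cotton.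
exact: prs_cotton_quasi_einstein.
Qed.
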